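(* Let $v,w$ be weights on $\mathbb{R}$. The family of operators $M_v^{1/2}T_\sigma M_w^{1/2}$, where $\sigma=(\sigma_I)_{I\in\mathcal{D}}$ ranges over all sequences of signs $\pm1$, is uniformly bounded in $L^2(\mathbb{R})$ (that is, $\sup_\sigma\|M_v^{1/2}T_\sigma M_w^{1/2}\|_{L^2\to L^2}<\infty$) if and only if there is a constant $C<\infty$ such that both of the following hold: (1) for every $J\in\mathcal{D}$, $\displaystyle \sup_\sigma \frac1{|J|}\int_J |T_\sigma(\chi_J w)|^2\, v\,dx\le C\langle w\rangle_J$; (2) for every $J\in\mathcal{D}$, $\displaystyle \sup_\sigma \frac1{|J|}\int_J |T_\sigma(\chi_J v)|^2\, w\,dx\le C\langle v\rangle_J$.
   Context: $\mathcal{D}$ is the set of dyadic intervals of $\mathbb{R}$; for $I\in\mathcal{D}$, $I_-$ and $I_+$ are its left and right halves, $|I|$ its length, $\chi_I$ its characteristic function, and $\langle f\rangle_I=\frac1{|I|}\int_I f\,dx$. A weight is a locally integrable function on $\mathbb{R}$ that is positive almost everywhere. The Haar function is $h_I=|I|^{-1/2}\chi_{I_-}-|I|^{-1/2}\chi_{I_+}$. For a sequence of signs $\sigma=(\sigma_I)_{I\in\mathcal{D}}$, $\sigma_I\in\{+1,-1\}$, $T_\sigma f=\sum_{I\in\mathcal{D}}\sigma_I (f,h_I)h_I$, where $(f,g)=\int_{\mathbb{R}} f g\,dx$; the series for $T_\sigma(\chi_J w)$ and $T_\sigma(\chi_J v)$ are taken in the sense of a.e. convergence. $M_v^{1/2}$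 and $M_w^{1/2}$ are the operators of multiplication by $v^{1/2}$ and $w^{1/2}$. The operators $M_v^{1/2}T_\sigma M_w^{1/2}$ are initially defined on bounded compactly supported functions $f$ (for which $w^{1/2}f\in L^2(\mathbb{R})$), and the norm is the best constant in the $L^2$ bound on such functions. *)

(* Defs.v *)
From mathcomp Require Import all_boot all_order all_algebra.
From mathcomp Require Import all_classical all_reals all_analysis.

Set Implicit Arguments.
Unset Strict Implicit.
Unset Printing Implicit Defensive.

Import Order.TTheory GRing.Theory Num.Theory.
Import numFieldNormedType.Exports.

Local Open Scope classical_set_scope.
Local Open Scope ring_scope.

(* The pair (k, m) encodes the interval [m 2^k, (m + 1) 2^k[; this is a
   bijection between int * int and the dyadic intervals. *)
Definition dyadic : Type := (int * int)%type.

Definition dlen (R : realType) (I : dyadic) : R := 2 ^ I.1.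

Definition dset (R : realType) (I : dyadic) : set R :=
  `[I.2%:~R * dlen R I, (I.2 + 1)%:~R * dlen R I[%classic.
Arguments dset R I : clear implicits.

Definition left_half (I : dyadic) : dyadic := (I.1 - 1, 2 * I.2).

Definition right_half (I : dyadic) : dyadic := (I.1 - 1, 2 * I.2 + 1).

Definition haar (R : realType) (I : dyadic) (x : R) : R :=
  (Num.sqrt (dlen R I))^-1 * \1_(dset R (left_half I)) x
  - (Num.sqrt (dlen R I))^-1 * \1_(dset R (right_half I)) x.

Definition pairing (R : realType) (f g : R -> R) : R :=
  \int[@lebesgue_measure R]_x (f x * g x).

Definition average (R : realType) (f : R -> R) (J : dyadic) : R :=
  (dlen R J)^-1 * \int[@lebesgue_measure R]_(x in dset R J) f x.

Definition weight (R : realType) (w : R -> R) : Prop :=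
  locally_integrable [set: R] w /\ {ae @lebesgue_measure R, forall x, 0 < w x}.

Definition signs (R : realType) : set (dyadic -> R) :=
  [set s | forall I, s I = 1 \/ s I = -1].
Arguments signs R : clear implicits.

(* The sum runs over the infinitely many intervals with 2^-n <= |I| <= 2^n,
   but for each x only 2n+1 of them contain x, so it has finite support. *)
Definition haar_partial_sum (R : realType) (s : dyadic -> R) (f : R -> R)
    (n : nat) (x : R) : R :=
  \sum_(I \in [set I : dyadic | (`|I.1| <= n)%N])
    s I * pairing f (haar I) * haar I x.

(* Pointwise sum of the Haar series.  For f in L^1 or L^2 the terms with large
   |I| are absolutely summable at every x, so truncating both ends of the scale
   range by the same n is harmless, and the limit exists almost everywhere; for
   f in L^2 it is almost everywhere equal to the sum of the series in L^2. *)
Definition haar_multiplier (R : realType) (s : dyadic -> R) (f : R -> R)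
    (x : R) : R :=
  limn (fun n => haar_partial_sum s f n x).

Definition mul_sqrt (R : realType) (u f : R -> R) (x : R) : R :=
  Num.sqrt (u x) * f x.

Definition two_weight_multiplier (R : realType) (v w : R -> R)
    (s : dyadic -> R) (f : R -> R) : R -> R :=
  mul_sqrt v (haar_multiplier s (mul_sqrt w f)).

Definition bounded_compactly_supported (R : realType) (f : R -> R) : Prop :=
  [/\ measurable_fun [set: R] f,
      exists M : R, forall x, `|f x| <= M
    & compact (closure [set x | f x != 0])].

(* Best constant in the L^2 bound, +oo if there is none. *)
Definition L2_opnorm (R : realType) (T : (R -> R) -> R -> R) : \bar R :=
  ereal_inf [set C%:E | C in [set C : R | 0 <= C /\
    forall f : R -> R, bounded_compactly_supported f ->
      (Lnorm (@lebesgue_measure R) 2%:E (EFin \o T f)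
       <= C%:E * Lnorm (@lebesgue_measure R) 2%:E (EFin \o f))%E]].

Definition restrict_dyadic (R : realType) (J : dyadic) (u : R -> R) (x : R) : R :=
  \1_(dset R J) x * u x.

Definition testing_condition (R : realType) (w v : R -> R) (C : R) : Prop :=
  forall J : dyadic,
    (ereal_sup [set ((dlen R J)^-1)%:E *
       \int[@lebesgue_measure R]_(x in dset R J)
         (`|haar_multiplier s (restrict_dyadic J w) x| ^+ 2 * v x)%:E
       | s in signs R]
     <= (C * average w J)%:E)%E.

(* Main.v *)
Require Import Defs.
From mathcomp Require Import all_boot all_order all_algebra.
From mathcomp Require Import all_classical all_reals all_analysis.
From mathcomp Require Import measurable_realfun ring lra zify.

(** The signs being arbitrary, uniform boundedness of the operators amounts to
absolute convergence of a bilinear form: the sum over I of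
|(phi, h_I) (psi, h_I)| is at most a constant times the integral of F + G,
for all phi, psi with phi ^ 2 <= w F and psi ^ 2 <= v G.  The pair
phi = w^(1/2) f, F = f ^ 2 encodes an input function, and psi = v S,
G = v S ^ 2, with S a finite Haar sum, computes the norm of an output.  The
estimate is symmetric in v and w, which explains the pair of dual conditions.

Sufficiency.  Let P I and W I be the integrals of phi and w over I.  The Haar
coefficient of phi is the coefficient of its martingale difference relative to
the measure w dx, plus (w, h_I) times the mean P I / W I; likewise for psi.
Expanding the product of two coefficients gives four sums.
- Difference against difference: martingale differences are orthogonal
  (sum_var_le), and the A2 bound on the product of the means of w and v controls
  the factors.
- The two mixed sums: Cauchy-Schwarz, orthogonality on one side and the Carleson
  embedding theorem on the other (carleson_embedding).  The Carleson condition
  is the testing condition with the square function in place of T_sigma.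
- Mean against mean: a positive bilinear form, split into the intervals where
  P ^ 2 / W dominates Q ^ 2 / V and the others.  On each half a stopping time for
  the dominating function, together with one testing condition, bounds the sum
  (heavy_embedding).
Everything is proved on finite dyadic trees by induction on the depth, with
explicit quantities in place of stopping intervals (bilinear_embedding).  The
hypotheses come from testing by a choice of signs: a single interval gives A2
(fin_test_A2), a greedy choice gives the square function (fin_test_square), and
the choice making all terms of a dual pairing nonnegative gives the positive
form (fin_test_dual, fin_test_stack).

Necessity.  Duality and a choice of signs turn the norm bound into the bilinear
estimate for bounded functions (weighted_bound_bilinear); truncation extends it
to phi = k w, psi = g v with k, g bounded on an interval J
(weighted_bound_bilinear_bound).  Both testing conditions follow on taking for k
the characteristic function of J, and for g a multiple of the finite Haar sum to
be estimated (bilinear_bound_fin_test).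

From T_sigma to finite Haar sums and back.  For constant signs the partial sums
telescope to differences of means, so they converge almost everywhere by the
Lebesgue differentiation theorem (window_sum1_cvg).  Hence T_sigma phi is a true
limit whenever sigma is constant off a finite list of intervals, and the finite
Haar sum over that list is the average of the two operators whose signs agree
with it on the list and are all +1, respectively all -1, elsewhere
(haar_multiplier_fix_signs_mean).  A bound for all signs therefore passes to
finite sums.  Conversely a bound for finite sums passes to T_sigma by Fatou's
lemma (haar_multiplier_fatou); at a point where the series diverges the value
of the limit operator is 0.

Finally, both sides depend on the weights only up to null sets, so that the
weights may be taken positive everywhere (positive_version). *)

Set Implicit Arguments.
Unset Strict Implicit.
Unset Printing Implicit Defensive.

Import Order.TTheory GRing.Theory Num.Theory.
Import numFieldNormedType.Exports.

Local Open Scope classical_set_scope.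
Local Open Scope ring_scope.

(** * Embedding theorems on finite dyadic trees *)

(** The descendants of J of generation less than n, J included. A list rather
than a set, so that sums over trees unfold by induction on n. *)
Fixpoint desc (n : nat) (J : dyadic) : seq dyadic :=
  if n is n'.+1 then J :: (desc n' (left_half J) ++ desc n' (right_half J))
  else [::].

Section Tree.
Context {R : realType}.
Implicit Types (W V P Q F G X a : dyadic -> R) (I J : dyadic) (n : nat).

Definition halves_additive P := forall I, P I = P (left_half I) + P (right_half I).

Lemma sum_desc0 a J : \sum_(I <- desc 0 J) a I = 0.
Proof. by rewrite big_nil. Qed.

Lemma sum_descS a n J : \sum_(I <- desc n.+1 J) a I =
  a J + (\sum_(I <- desc n (left_half J)) a I +
         \sum_(I <- desc n (right_half J)) a I).
Proof. by rewrite /= big_cons big_cat. Qed.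

Lemma weighted_amgm (x y t : R) : 0 < t -> 2 * (x * y) <= t * x ^+ 2 + y ^+ 2 / t.
Proof.
move=> t0.
rewrite -subr_ge0 [leRHS](_ : _ = (t * x - y) ^+ 2 / t).
  by rewrite divr_ge0 ?sqr_ge0 ?ltW.
by field; rewrite gt_eqF.
Qed.

(** The integral over J of v times the square of t plus the sum of (a I / V I)
chi_I over the tree, V I being the integral of v over I. The recursion carries
in t the part of the sum already collected above J. *)
Fixpoint stack_norm2 V a n J (t : R) : R :=
  if n is n'.+1 then
    stack_norm2 V a n' (left_half J) (t + a J / V J) +
    stack_norm2 V a n' (right_half J) (t + a J / V J)
  else t ^+ 2 * V J.

Lemma stack_norm2_ge V a n J t : (forall I, 0 < V I) -> (forall I, 0 <= a I) ->
  halves_additive V -> 0 <= t -> t ^+ 2 * V J <= stack_norm2 V a n J t.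
Proof.
move=> V0 a0 Vadd; elim: n J t => [|n IH] J t t0 //=.
have ta : 0 <= a J / V J by rewrite divr_ge0// ltW.
apply: le_trans (lerD (IH _ _ (addr_ge0 t0 ta)) (IH _ _ (addr_ge0 t0 ta))).
rewrite -mulrDr -Vadd ler_wpM2r ?(ltW (V0 _))// ler_sqr ?nnegrE ?addr_ge0//.
by rewrite lerDl.
Qed.

Section Embedding.
Variables (W V P Q F G a : dyadic -> R) (C : R).
Hypotheses (W0 : forall I, 0 < W I) (V0 : forall I, 0 < V I)
  (Wadd : halves_additive W) (Vadd : halves_additive V)
  (P0 : forall I, 0 <= P I) (Q0 : forall I, 0 <= Q I)
  (Padd : halves_additive P) (Qadd : halves_additive Q)
  (Fadd : halves_additive F) (Gadd : halves_additive G)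
  (PF : forall I, P I ^+ 2 <= W I * F I) (QG : forall I, Q I ^+ 2 <= V I * G I)
  (a0 : forall I, 0 <= a I) (C0 : 0 <= C)
  (testV : forall n J, stack_norm2 V a n J 0 <= C * W J).

Definition heavy I := Q I ^+ 2 / V I <= P I ^+ 2 / W I.

Let heavy_sum n J :=
  \sum_(I <- desc n J | heavy I) a I * (P I / W I) * (Q I / V I).

Lemma heavy_sumS n J : heavy_sum n.+1 J =
  (if heavy J then a J * (P J / W J) * (Q J / V J) else 0) +
  (heavy_sum n (left_half J) + heavy_sum n (right_half J)).
Proof.
rewrite /heavy_sum /= big_cons big_cat /=.
by case: ifP => // _; rewrite add0r.
Qed.

(** The stopping-time argument as an induction. The state at J consists of s,
the mean P / W at the last stopping interval above J, and t, the sum of a I /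
V I over the intervals I between it and J. As long as the mean at heavy
intervals stays below 2 s, a term a p q is at most 2 s (a I / V I) Q I, which
is absorbed by increasing t in the cross term 2 s t Q. At a heavy interval
whose mean p exceeds 2 s the state restarts from (p, 0); heaviness lets the
cross term left behind be paid by P ^ 2 / W. When P and F are the integrals of
f w and f ^ 2 w, the last summand is a multiple of the integral of (f - s) ^ 2
w: it is additive in J for fixed s, and it drops by a multiple of p ^ 2 W at
each stop. *)
Lemma heavy_embedding_state n J (s t : R) : 0 <= s -> 0 <= t ->
  heavy_sum n J + 2 * s * t * Q J <=
  s ^+ 2 * stack_norm2 V a n J t + G J +
  4 * (C + 1) * (F J - 2 * s * P J + s ^+ 2 * W J).
Proof.
have QV I : Q I ^+ 2 / V I <= G I by rewrite ler_pdivrMr// mulrC.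
have rest_ge0 I r : 0 <= F I - 2 * r * P I + r ^+ 2 * W I.
  have : P I ^+ 2 / W I <= F I by rewrite ler_pdivrMr// mulrC.
  have : 2 * (r * P I) <= W I * r ^+ 2 + P I ^+ 2 / W I by exact: weighted_amgm.
  lra.
have cross (r u : R) I : 2 * r * u * Q I <= r ^+ 2 * (u ^+ 2 * V I) + Q I ^+ 2 / V I.
  by have := weighted_amgm (r * u) (Q I) (V0 I); rewrite exprMn; lra.
elim: n J s t => [|n IH] J s t s0 t0.
  rewrite /heavy_sum big_nil add0r /=.
  have := cross s t J; have := QV J; have := rest_ge0 J s.
  have : 0 <= C * (F J - 2 * s * P J + s ^+ 2 * W J) by rewrite mulr_ge0.
  lra.
have aV : 0 <= a J / V J by rewrite divr_ge0// ltW.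
(* a step keeping the state r, also used at a stop with r = p and u = 0 *)
have nostop (r u : R) : 0 <= r -> 0 <= u -> (heavy J -> P J / W J <= 2 * r) ->
  heavy_sum n.+1 J + 2 * r * u * Q J <=
  r ^+ 2 * stack_norm2 V a n.+1 J u + G J +
  4 * (C + 1) * (F J - 2 * r * P J + r ^+ 2 * W J).
  move=> r0 u0 Hr; rewrite heavy_sumS.
  have ua : 0 <= u + a J / V J by rewrite addr_ge0.
  have HJ : (if heavy J then a J * (P J / W J) * (Q J / V J) else 0) <=
            2 * r * (a J / V J) * (Q (left_half J) + Q (right_half J)).
    case: ifP => hJ; last by rewrite -Qadd mulr_ge0 ?Q0 // mulr_ge0 // mulr_ge0.
    rewrite -Qadd [leRHS](_ : _ = a J * (2 * r) * (Q J / V J)); last by ring.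
    by rewrite ler_wpM2r ?divr_ge0 ?(ltW (V0 J))// ler_wpM2l// Hr.
  rewrite -addrA; apply: le_trans (lerD HJ (lexx _)) _.
  rewrite (Fadd J) (Padd J) (Wadd J) (Gadd J) [in X in _ + X <= _]Qadd.
  have := IH (left_half J) _ _ r0 ua; have := IH (right_half J) _ _ r0 ua.
  by rewrite /=; lra.
have [hJ|hJ] := boolP (heavy J); last by apply: nostop => // h; rewrite h in hJ.
have [|ps] := leP (P J / W J) (2 * s); first by move=> ?; exact: nostop.
set p := P J / W J in ps.
have p0 : 0 <= p by rewrite divr_ge0// ltW.
have PE : P J = p * W J by rewrite /p divfK// gt_eqF.
have := nostop p 0 p0 (lexx _) _; rewrite mulr0 mul0r addr0.
move=> /(_ (fun=> _)) /=; rewrite -/p => /(_ ltac:(lra)) Hp.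
have T0 := testV n.+1 J.
have Tt : t ^+ 2 * V J <= stack_norm2 V a n.+1 J t by exact: stack_norm2_ge.
have sT : s ^+ 2 * (t ^+ 2 * V J) <= s ^+ 2 * stack_norm2 V a n.+1 J t.
  by rewrite ler_wpM2l ?sqr_ge0.
have pT : p ^+ 2 * stack_norm2 V a n.+1 J 0 <= p ^+ 2 * (C * W J).
  by rewrite ler_wpM2l ?sqr_ge0.
have := cross s t J; move: (hJ); rewrite /heavy => hJ'.
have PW : P J ^+ 2 / W J = p ^+ 2 * W J.
  by rewrite PE; field; rewrite gt_eqF.
rewrite PW in hJ'.
(* the last summand drops by 4 (C + 1) (p - s) ^ 2 W >= (C + 1) p ^ 2 W, which
   pays for the new stopping interval *)
have gain : (C + 1) * W J * p ^+ 2 <= (C + 1) * W J * (4 * (p - s) ^+ 2).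
  rewrite ler_wpM2l//; first by rewrite mulr_ge0 ?addr_ge0// ltW.
  by nra.
by move: Hp gain pT sT; rewrite PE /=; lra.
Qed.

Lemma heavy_embedding n J : heavy_sum n J <= G J + 4 * (C + 1) * F J.
Proof.
have := @heavy_embedding_state n J 0 0 (lexx _) (lexx _).
by rewrite expr0n /= !(mulr0, mul0r, addr0, subr0, add0r).
Qed.

End Embedding.

Lemma sqr_div_subadd (x1 x2 y1 y2 : R) : 0 < y1 -> 0 < y2 ->
  (x1 + x2) ^+ 2 / (y1 + y2) <= x1 ^+ 2 / y1 + x2 ^+ 2 / y2.
Proof.
move=> y1_gt0 y2_gt0; rewrite -subr_ge0.
rewrite [leRHS](_ : _ = (x1 * y2 - x2 * y1) ^+ 2 / (y1 * y2 * (y1 + y2))).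
  by rewrite divr_ge0 ?sqr_ge0// !mulr_ge0 ?addr_ge0// ltW.
by field; rewrite !gt_eqF ?addr_gt0.
Qed.

(** Bellman-function proof: F - P ^ 2 / (W + X / C), where X is the total
Carleson mass below J, is nonnegative, concave in its variables, and increases
by at least c p ^ 2 / (4 C) when X increases by c, since W + X / C <= 2 W. *)
Lemma carleson_embedding W P F (c : dyadic -> R) (C : R) n J :
  (forall I, 0 < W I) -> halves_additive W -> halves_additive P -> halves_additive F ->
  (forall I, P I ^+ 2 <= W I * F I) -> (forall I, 0 <= c I) -> 0 < C ->
  (forall n J, \sum_(I <- desc n J) c I <= C * W J) ->
  \sum_(I <- desc n J) c I * (P I / W I) ^+ 2 <= 4 * C * F J.
Proof.
move=> W0 Wadd Padd Fadd PF c0 C0 car.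
pose Y n J := W J + (\sum_(I <- desc n J) c I) / C.
have Y0 m I : 0 < Y m I.
  by rewrite ltr_wpDr// divr_ge0 ?sumr_ge0// ltW.
have Yle m I : Y m I <= 2 * W I.
  have : (\sum_(I' <- desc m I) c I') / C <= W I by rewrite ler_pdivrMr// mulrC.
  by rewrite /Y; lra.
suff H : \sum_(I <- desc n J) c I * (P I / W I) ^+ 2 <=
    4 * C * (F J - P J ^+ 2 / Y n J).
  apply: le_trans H _; rewrite ler_wpM2l ?mulr_ge0 ?(ltW C0)//.
  by rewrite lerBlDr lerDl divr_ge0 ?sqr_ge0// ltW.
elim: n J => [|n IH] J.
  rewrite sum_desc0 /Y sum_desc0 mul0r addr0 mulr_ge0 ?mulr_ge0 ?(ltW C0)//.
  by rewrite subr_ge0 ler_pdivrMr// mulrC.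
rewrite sum_descS; apply: le_trans (lerD (lexx _) (lerD (IH _) (IH _))) _.
have := @sqr_div_subadd (P (left_half J)) (P (right_half J)) _ _
  (Y0 n (left_half J)) (Y0 n (right_half J)).
rewrite -Padd; set y := Y n _ + Y n _.
have YE : Y n.+1 J = y + c J / C.
  by rewrite /y /Y sum_descS (Wadd J); field; rewrite gt_eqF.
have y0 : 0 < y by rewrite addr_gt0.
clearbody y.
have cC : 0 <= c J / C by rewrite divr_ge0// ltW.
have gain : c J * (P J / W J) ^+ 2 <=
    4 * C * (P J ^+ 2 / y - P J ^+ 2 / (y + c J / C)).
  rewrite [leRHS](_ : _ = 4 * c J * P J ^+ 2 / (y * (y + c J / C))); last first.
    field; rewrite (gt_eqF C0) (gt_eqF y0) andbT gt_eqF//.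
    by apply: ltr_wpDr => //; exact: mulr_gt0.
  rewrite exprMn exprVn mulrA ler_pdivrMr ?exprn_gt0//.
  rewrite mulrAC ler_pdivlMr ?mulr_gt0 ?ltr_wpDr//.
  have -> : 4 * c J * P J ^+ 2 * W J ^+ 2 = c J * P J ^+ 2 * ((2 * W J) * (2 * W J)).
    by ring.
  apply: ler_wpM2l; first by rewrite mulr_ge0 ?sqr_ge0.
  apply: ler_pM; [exact: ltW|exact: addr_ge0 (ltW y0) cC| |].
    by apply: le_trans (Yle n.+1 J); rewrite YE lerDl.
  by rewrite -YE.
move=> titu; have := ler_wpM2l (ltW C0) titu.
by rewrite YE (Fadd J); lra.
Qed.

Definition delta P J := P (left_half J) - P (right_half J).

(** Square norm, in L^2 of the weight, of the martingale difference at J of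
the function with integrals P against the weight. *)
Definition var W P J := P (left_half J) ^+ 2 / W (left_half J) +
  P (right_half J) ^+ 2 / W (right_half J) - P J ^+ 2 / W J.

Lemma var_ge0 W P J : (forall I, 0 < W I) -> halves_additive W -> halves_additive P ->
  0 <= var W P J.
Proof.
move=> W0 Wadd Padd; rewrite subr_ge0 (Padd J) (Wadd J).
exact: sqr_div_subadd.
Qed.

(** Orthogonality of martingale differences: the increments telescope to F - P
^ 2 / W. *)
Lemma sum_var_le W P F n J : (forall I, 0 < W I) -> halves_additive F ->
  (forall I, P I ^+ 2 <= W I * F I) -> \sum_(I <- desc n J) var W P I <= F J.
Proof.
move=> W0 Fadd PF.
suff: \sum_(I <- desc n J) var W P I <= F J - P J ^+ 2 / W J.
  by move/le_trans; apply; rewrite lerBlDr lerDl divr_ge0 ?sqr_ge0 ?ltW.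
elim: n J => [|n IH] J.
  by rewrite sum_desc0 subr_ge0 ler_pdivrMr// mulrC.
rewrite sum_descS; apply: le_trans (lerD (lexx _) (lerD (IH _) (IH _))) _.
by rewrite /var (Fadd J); lra.
Qed.

Lemma sqr_martingale_diff W P J : (forall I, 0 < W I) ->
  halves_additive W -> halves_additive P ->
  (delta P J - delta W J * (P J / W J)) ^+ 2 =
  4 * (W (left_half J) * W (right_half J) / W J) * var W P J.
Proof.
move=> W0 Wadd Padd; rewrite /delta /var (Padd J) (Wadd J).
by field; rewrite !gt_eqF ?addr_gt0.
Qed.

(** The first bound fits the mixed sums, where the factor W J is matched with
a square-function coefficient. The second involves only the left half, which
is the interval on which testing with the single Haar function h_J gives the
A2 bound. *)
Lemma sqr_martingale_diff_le W P J : (forall I, 0 < W I) ->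
  halves_additive W -> halves_additive P ->
  (delta P J - delta W J * (P J / W J)) ^+ 2 <= W J * var W P J /\
  (delta P J - delta W J * (P J / W J)) ^+ 2 <= 4 * W (left_half J) * var W P J.
Proof.
move=> W0 Wadd Padd; rewrite sqr_martingale_diff//.
have v0 := var_ge0 J W0 Wadd Padd.
split; apply: ler_wpM2r => //.
  rewrite mulrA ler_pdivrMr// (Wadd J).
  have := sqr_ge0 (W (left_half J) - W (right_half J)); lra.
rewrite ler_wpM2l// ler_pdivrMr// ler_wpM2l ?(ltW (W0 _))// (Wadd J).
by rewrite lerDr ltW.
Qed.

Section Bilinear.
Variables (W V len : dyadic -> R) (A C : R).
Hypotheses (W0 : forall I, 0 < W I) (V0 : forall I, 0 < V I)
  (len0 : forall I, 0 < len I)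
  (Wadd : halves_additive W) (Vadd : halves_additive V) (A0 : 0 <= A) (C0 : 0 < C).

(** The term of index I in the square function of the coefficients of U,
integrated against U'. *)
Definition square_coef U U' I := (delta U I / len I) ^+ 2 * U' I.

Definition cross_coef I := `|delta W I * delta V I| / len I.

Hypotheses
  (A2 : forall I, W (left_half I) * V (left_half I) <= A * len I ^+ 2)
  (sqW : forall n J, \sum_(I <- desc n J) square_coef W V I <= C * W J)
  (sqV : forall n J, \sum_(I <- desc n J) square_coef V W I <= C * V J)
  (testV : forall n J, stack_norm2 V cross_coef n J 0 <= C * W J)
  (testW : forall n J, stack_norm2 W cross_coef n J 0 <= C * V J).

(** Each interval is heavy for at least one of the two orders of the weights,
so the positive form is the sum of two heavy parts. *)
Lemma cross_embedding P Q F G n J :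
  (forall I, 0 <= P I) -> (forall I, 0 <= Q I) ->
  halves_additive P -> halves_additive Q -> halves_additive F -> halves_additive G ->
  (forall I, P I ^+ 2 <= W I * F I) -> (forall I, Q I ^+ 2 <= V I * G I) ->
  \sum_(I <- desc n J) cross_coef I * (P I / W I) * (Q I / V I) <=
  (4 * C + 5) * (F J + G J).
Proof.
move=> P0 Q0 Padd Qadd Fadd Gadd PF QG.
have cc I : 0 <= cross_coef I by rewrite divr_ge0 ?(ltW (len0 I)).
have cc0 I : 0 <= cross_coef I * (P I / W I) * (Q I / V I).
  by apply: mulr_ge0; [apply: mulr_ge0 => //|]; apply: divr_ge0 => //; exact: ltW.
have H1 := heavy_embedding W0 V0 Wadd Vadd P0 Q0 Padd Qadd Fadd Gadd PF QG cc
  (ltW C0) testV n J.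
have H2 := heavy_embedding V0 W0 Vadd Wadd Q0 P0 Qadd Padd Gadd Fadd QG PF cc
  (ltW C0) testW n J.
apply: le_trans (_ : _ <= (G J + 4 * (C + 1) * F J) + (F J + 4 * (C + 1) * G J)) _;
  last by lra.
apply: le_trans (lerD H1 H2); rewrite [leLHS](bigID (heavy W V P Q)) /=.
rewrite lerD2l big_mkcond [leRHS]big_mkcond; apply: ler_sum => I _.
rewrite /heavy -ltNge; case: ifPn => [/ltW ->|_]; first by rewrite mulrAC.
by case: ifP => // _; rewrite mulrAC cc0.
Qed.

Definition bilinear_const := 4 * C + 5 + 5 * C + 4 * A + 4.

Lemma mixed_term_le (x d U' l v p : R) : 0 < l -> 0 < U' ->
  d ^+ 2 <= U' * v -> `|x * p * d| / l <= (x / l) ^+ 2 * U' * p ^+ 2 + v.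
Proof.
move=> l0 U0 dv.
have := weighted_amgm (`|x * p| / l) `|d| U0.
rewrite exprMn exprVn !real_normK ?num_real//.
have : d ^+ 2 / U' <= v by rewrite ler_pdivrMr// mulrC.
have := mulr_ge0 (mulr_ge0 (normr_ge0 (x * p)) (normr_ge0 d)) (ltW l0).
have : 0 <= `|x * p * d| / l by rewrite divr_ge0// ltW.
rewrite !normrM !exprMn !exprVn.
have -> : `|x| * `|p| / l * `|d| = `|x| * `|p| * `|d| / l by ring.
by lra.
Qed.

Lemma diff_term_le (d e u v a l x y : R) : 0 < l -> 0 <= a -> 0 <= x -> 0 <= y ->
  0 <= u -> 0 <= v ->
  d ^+ 2 <= 4 * u * x -> e ^+ 2 <= 4 * v * y -> u * v <= a * l ^+ 2 ->
  `|d * e| / l <= 2 * (a + 1) * (x + y).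
Proof.
move=> l0 a0 x0 y0 u0 v0 dx ey uv.
rewrite -ler_sqr ?nnegrE ?divr_ge0 ?mulr_ge0 ?addr_ge0 ?(ltW l0)//.
rewrite exprMn exprVn real_normK ?num_real// ler_pdivrMr ?exprn_gt0//.
rewrite exprMn; apply: le_trans (_ : 16 * (u * v) * (x * y) <= _).
  have := ler_pM (sqr_ge0 d) (sqr_ge0 e) dx ey; lra.
apply: le_trans (_ : 16 * (a * l ^+ 2) * (x * y) <= _).
  by rewrite ler_wpM2r ?mulr_ge0// ler_wpM2l.
rewrite -subr_ge0 [leRHS](_ : _ = 4 * l ^+ 2 *
  ((a ^+ 2 + a + 1) * (x + y) ^+ 2 + a * (x - y) ^+ 2)); last by ring.
apply: mulr_ge0; first by rewrite mulr_ge0 ?sqr_ge0.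
apply: addr_ge0; apply: mulr_ge0 => //; rewrite ?sqr_ge0//.
by rewrite !addr_ge0 ?sqr_ge0.
Qed.

(** Discrete core of the theorem. P and Q are integrals of signed functions;
P' and Q' are those of their absolute values, to which cross_embedding is
applied. *)
Lemma bilinear_embedding P P' Q Q' F G n J :
  halves_additive P -> halves_additive Q -> halves_additive P' -> halves_additive Q' ->
  halves_additive F -> halves_additive G ->
  (forall I, `|P I| <= P' I) -> (forall I, `|Q I| <= Q' I) ->
  (forall I, P' I ^+ 2 <= W I * F I) -> (forall I, Q' I ^+ 2 <= V I * G I) ->
  \sum_(I <- desc n J) `|delta P I * delta Q I| / len I <=
  bilinear_const * (F J + G J).
Proof.
move=> Padd Qadd P'add Q'add Fadd Gadd PP QQ PF QG.
have sqn (x y : R) : `|x| <= y -> x ^+ 2 <= y ^+ 2.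
  by move=> xy; rewrite -real_normK ?num_real// ler_sqr ?nnegrE// (le_trans _ xy).
have P'0 I : 0 <= P' I by exact: le_trans (PP I).
have Q'0 I : 0 <= Q' I by exact: le_trans (QQ I).
have PF1 I : P I ^+ 2 <= W I * F I := le_trans (sqn _ _ (PP I)) (PF I).
have QG1 I : Q I ^+ 2 <= V I * G I := le_trans (sqn _ _ (QQ I)) (QG I).
have sW0 I : 0 <= square_coef W V I by apply: mulr_ge0; [exact: sqr_ge0|exact: ltW].
have sV0 I : 0 <= square_coef V W I by apply: mulr_ge0; [exact: sqr_ge0|exact: ltW].
have CP := carleson_embedding n J W0 Wadd Padd Fadd PF1 sW0 C0 sqW.
have CQ := carleson_embedding n J V0 Vadd Qadd Gadd QG1 sV0 C0 sqV.
have VP := sum_var_le n J W0 Fadd PF1.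
have VQ := sum_var_le n J V0 Gadd QG1.
have CE := cross_embedding n J P'0 Q'0 P'add Q'add Fadd Gadd PF QG.
have F0 : 0 <= F J by rewrite -(pmulr_rge0 _ (W0 J)) (le_trans _ (PF J)) ?sqr_ge0.
have G0 : 0 <= G J by rewrite -(pmulr_rge0 _ (V0 J)) (le_trans _ (QG J)) ?sqr_ge0.
suff H : forall I, `|delta P I * delta Q I| / len I <=
    2 * (A + 1) * (var W P I + var V Q I) +
    (square_coef W V I * (P I / W I) ^+ 2 + var V Q I) +
    (square_coef V W I * (Q I / V I) ^+ 2 + var W P I) +
    cross_coef I * (P' I / W I) * (Q' I / V I).
  apply: le_trans (ler_sum _ (fun I _ => H I)) _.
  move: (var W P) (var V Q) VP VQ {H} => vP vQ VP VQ.
  rewrite !big_split /= -mulr_sumr big_split /=.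
  have := ler_wpM2l A0 VP; have := ler_wpM2l A0 VQ.
  have := mulr_ge0 (ltW C0) F0; have := mulr_ge0 (ltW C0) G0.
  have := mulr_ge0 A0 F0; have := mulr_ge0 A0 G0.
  by rewrite /bilinear_const; lra.
move=> I.
have [d1 d2] := sqr_martingale_diff_le I W0 Wadd Padd.
have [e1 e2] := sqr_martingale_diff_le I V0 Vadd Qadd.
have v1 := var_ge0 I W0 Wadd Padd; have v2 := var_ge0 I V0 Vadd Qadd.
set p := P I / W I in d1 d2 *; set q := Q I / V I in e1 e2 *.
set d := delta P I - _ in d1 d2; set e := delta Q I - _ in e1 e2.
have -> : delta P I * delta Q I =
    d * e + delta W I * p * e + delta V I * q * d +
    (delta W I * delta V I) * (p * q) by rewrite /d /e; ring.
have T1 := diff_term_le (len0 I) A0 v1 v2 (ltW (W0 _)) (ltW (V0 _)) d2 e2 (A2 I).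
have T2 := mixed_term_le (delta W I) p (len0 I) (V0 I) e1.
have T3 := mixed_term_le (delta V I) q (len0 I) (W0 I) d1.
have T4 : `|delta W I * delta V I * (p * q)| / len I <=
    cross_coef I * (P' I / W I) * (Q' I / V I).
  have le_avg (x y u : R) : 0 < u -> `|x| <= y -> `|x / u| <= y / u.
    by move=> u0 xy; rewrite normrM normfV (gtr0_norm u0) ler_wpM2r ?invr_ge0 ?(ltW u0).
  rewrite normrM mulrAC -/(cross_coef I) -mulrA.
  apply: ler_wpM2l; first by rewrite divr_ge0 ?(ltW (len0 I)).
  by rewrite normrM ler_pM ?le_avg.
apply: le_trans (lerD (lerD (lerD T1 T2) T3) T4).
rewrite -!(mulrDl _ _ (len I)^-1) ler_wpM2r ?invr_ge0 ?(ltW (len0 I))//.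
by do 3 (apply: le_trans (ler_normD _ _) _; rewrite ?lerD2r).
Qed.

End Bilinear.
End Tree.

(** * Geometry of dyadic intervals and Haar functions *)

Section Geometry.
Context {R : realType}.
Implicit Types (I J : dyadic) (n N : nat) (x : R).

Lemma dlen_gt0 I : 0 < dlen R I.
Proof. by rewrite /dlen exprz_gt0. Qed.

Lemma dlen_left_half I : dlen R (left_half I) = dlen R I / 2.
Proof. by rewrite /dlen /= expfzDr. Qed.

Lemma dlen_right_half I : dlen R (right_half I) = dlen R I / 2.
Proof. by rewrite /dlen /= expfzDr. Qed.

Lemma dsetE I x : dset R I x <->
  I.2%:~R * dlen R I <= x /\ x < (I.2%:~R + 1) * dlen R I.
Proof.
rewrite /dset /= in_itv /= intrD; split => [/andP//|[? ?]]; exact/andP.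
Qed.

Lemma dset_left_halfE I x : dset R (left_half I) x <->
  I.2%:~R * dlen R I <= x /\ x < (I.2%:~R + 2^-1) * dlen R I.
Proof.
rewrite dsetE dlen_left_half /= intrM.
have -> : 2%:~R * I.2%:~R * (dlen R I / 2) = I.2%:~R * dlen R I by field.
by have -> : (2%:~R * I.2%:~R + 1) * (dlen R I / 2) =
  (I.2%:~R + 2^-1) * dlen R I by field.
Qed.

Lemma dset_right_halfE I x : dset R (right_half I) x <->
  (I.2%:~R + 2^-1) * dlen R I <= x /\ x < (I.2%:~R + 1) * dlen R I.
Proof.
rewrite dsetE dlen_right_half /= intrD intrM.
have -> : (2%:~R * I.2%:~R + 1%:~R) * (dlen R I / 2) =
  (I.2%:~R + 2^-1) * dlen R I by field.
by have -> : (2%:~R * I.2%:~R + 1%:~R + 1) * (dlen R I / 2) =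
  (I.2%:~R + 1) * dlen R I by field.
Qed.

Lemma dset_halves I x :
  dset R I x <-> dset R (left_half I) x \/ dset R (right_half I) x.
Proof.
rewrite dsetE dset_left_halfE dset_right_halfE.
have := dlen_gt0 I; set m : R := I.2%:~R; set l := dlen R I => l0.
have l2 : 0 < 2^-1 * l by rewrite mulr_gt0.
rewrite !mulrDl !mul1r; split=> [[h1 h2]|[[h1 h2]|[h1 h2]]]; try lra.
Qed.

Lemma dset_halves_disjoint I x :
  dset R (left_half I) x -> dset R (right_half I) x -> False.
Proof. by rewrite dset_left_halfE dset_right_halfE; lra. Qed.

Lemma measurable_dset I : measurable (dset R I : set (measurableTypeR R)).
Proof. exact: measurable_itv. Qed.

Lemma lebesgue_dset I : lebesgue_measure (dset R I) = (dlen R I)%:E.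
Proof.
rewrite /dset lebesgue_measure_itv /= lte_fin intrD.
have l0 := dlen_gt0 I; rewrite mulrDl mul1r ltrDl l0.
by rewrite -EFinD; congr EFin; ring.
Qed.

Lemma dset_nonempty I : dset R I (I.2%:~R * dlen R I).
Proof. by apply/dsetE; split => //; rewrite mulrDl mul1r ltrDl dlen_gt0. Qed.

Lemma dset_scale_inj I J x : I.1 = J.1 -> dset R I x -> dset R J x -> I = J.
Proof.
case: I J => [k m] [k' m'] /= <- /dsetE[/= h1 h2] /dsetE[/= h3 h4].
congr pair; have l0 := dlen_gt0 (k, m).
have : m < m' + 1.
  by rewrite -(ltr_int R) intrD -(ltr_pM2r l0); exact: le_lt_trans h4.
have : m' < m + 1.
  by rewrite -(ltr_int R) intrD -(ltr_pM2r l0); exact: le_lt_trans h2.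
lia.
Qed.

Lemma desc_sub n I J x : I \in desc n J -> dset R I x -> dset R J x.
Proof.
elim: n J => [|n IH] J //=; rewrite inE mem_cat => /or3P[/eqP->//|h|h] Ix; apply/dset_halves.
  by left; exact: IH h Ix.
by right; exact: IH h Ix.
Qed.

Lemma desc_scale n I J : I \in desc n J ->
  (I.1 <= J.1)%R /\ (J.1 < I.1 + n%:Z)%R.
Proof.
elim: n J => [|n IH] J //=; rewrite inE mem_cat => /or3P[/eqP->|h|h].
- lia.
- have := IH _ h; rewrite /=; lia.
- have := IH _ h; rewrite /=; lia.
Qed.

Lemma mem_desc n I J x : dset R I x -> dset R J x ->
  (I.1 <= J.1)%R -> (J.1 < I.1 + n%:Z)%R -> I \in desc n J.
Proof.
elim: n J => [|n IH] J Ix Jx IJ JIn; first by lia.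
rewrite /= inE mem_cat; have [e|e] := eqVneq I.1 J.1.
  by rewrite (dset_scale_inj e Ix Jx) eqxx.
apply/or3P; move/dset_halves: Jx => [h|h].
  by apply: Or32; apply: IH h _ _ => //=; lia.
by apply: Or33; apply: IH h _ _ => //=; lia.
Qed.

Lemma desc_uniq n J : uniq (desc n J).
Proof.
elim: n J => [|n IH] J //=; rewrite cat_uniq !IH /= andbT.
apply/andP; split.
  rewrite mem_cat; apply/negP => /orP[|] /desc_scale/=; lia.
apply/hasPn => I Ir; apply/negP => Il.
exact: (dset_halves_disjoint (desc_sub Il (dset_nonempty I))
  (desc_sub Ir (dset_nonempty I))).
Qed.

(** The intervals of length between 2^-N and 2^N that are contained in [-2^N,
2^N[. On that range their Haar sum is the partial sum of order N. *)
Definition window N : seq dyadic :=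
  desc (2 * N + 1) (N%:Z, -1) ++ desc (2 * N + 1) (N%:Z, 0).

Lemma dset_windowE N x : dset R (N%:Z, -1) x \/ dset R (N%:Z, 0) x <->
  - 2 ^+ N <= x < 2 ^+ N.
Proof.
have l0 : 0 < 2 ^+ N :> R by rewrite exprn_gt0.
rewrite !dsetE /dlen /= -exprnP mulN1r mul0r add0r mul1r addNr mul0r.
split=> [[[h1 h2]|[h1 h2]]|/andP[h1 h2]]; first by apply/andP; split; lra.
  by apply/andP; split; lra.
by have [h|h] := ltP x 0; [left|right].
Qed.

Lemma mem_window N I x : dset R I x -> (`|I.1| <= N)%N ->
  - 2 ^+ N <= x < 2 ^+ N -> I \in window N.
Proof.
move=> Ix IN /dset_windowE[h|h]; rewrite /window mem_cat; apply/orP; [left|right];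
  by apply: (mem_desc Ix h) => /=; lia.
Qed.

Lemma window_scale N I : I \in window N -> (`|I.1| <= N)%N.
Proof. by rewrite mem_cat => /orP[] /desc_scale /=; lia. Qed.

Lemma window_uniq N : uniq (window N).
Proof.
rewrite cat_uniq !desc_uniq /= andbT; apply/hasPn => I I1; apply/negP => I2.
have := desc_sub I1 (dset_nonempty I); have := desc_sub I2 (dset_nonempty I).
move=> h1 h2; have /= := @dset_scale_inj (N%:Z, -1) (N%:Z, 0) _ erefl h1 h2.
by case.
Qed.

Lemma near_window x : \forall N \near \oo, - 2 ^+ N <= x < 2 ^+ N.
Proof.
exists (Num.truncn `|x|).+1 => // N /= hN.
suff h : `|x| < 2 ^+ N by move: h; rewrite ltr_norml => /andP[/ltW -> ->].
apply: (lt_le_trans (truncnS_gt _)).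
by rewrite -natrX ler_nat (leq_trans hN)// ltnW// ltn_expl.
Qed.
Lemma haar_out I x : ~ dset R I x -> haar I x = 0.
Proof.
move=> Ix; rewrite /haar !indicE !memNset ?mulr0 ?subr0//.
  by move=> h; apply/Ix/dset_halves; right.
by move=> h; apply/Ix/dset_halves; left.
Qed.

Lemma haar_left I x : dset R (left_half I) x ->
  haar I x = (Num.sqrt (dlen R I))^-1.
Proof.
move=> h; rewrite /haar !indicE mem_set// memNset ?mulr1 ?mulr0 ?subr0//.
exact: dset_halves_disjoint h.
Qed.

Lemma haar_right I x : dset R (right_half I) x ->
  haar I x = - (Num.sqrt (dlen R I))^-1.
Proof.
move=> h; have hl : ~ dset R (left_half I) x.
  by move=> /dset_halves_disjoint; apply.
by rewrite /haar !indicE (mem_set h) (memNset hl) mulr1 mulr0 sub0r.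
Qed.

Lemma sqrt_dlenK I : (Num.sqrt (dlen R I))^-1 * (Num.sqrt (dlen R I))^-1 =
  (dlen R I)^-1.
Proof. by rewrite -invfM -expr2 sqr_sqrtr// ltW// dlen_gt0. Qed.

Lemma partial_sum_window (s : dyadic -> R) f N x : - 2 ^+ N <= x < 2 ^+ N ->
  haar_partial_sum s f N x =
  \sum_(I <- window N) s I * pairing f (haar I) * haar I x.
Proof.
move=> hx; rewrite /haar_partial_sum [RHS]fsbig_seq ?window_uniq//; apply/esym.
apply: fsbig_widen => [I /= /window_scale//|I /= [IN Iw]].
rewrite haar_out ?mulr0// => Ix; apply: Iw; exact: mem_window Ix IN hx.
Qed.

End Geometry.

(** * Integrals over dyadic intervals *)

Section Integrals.
Context {R : realType}.
Notation mu := (@lebesgue_measure R).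
Implicit Types (I J : dyadic) (f g k phi psi w : R -> R) (D : set (measurableTypeR R)).

Definition intble D f := mu.-integrable D (EFin \o f).

(** Integrability on dyadic intervals is all that the tree arguments use. *)
Definition locint f := measurable_fun [set: R] f /\ forall I, intble (dset R I) f.

Definition bdd_measurable k :=
  measurable_fun [set: R] k /\ exists M : R, forall x, `|k x| <= M.

Lemma intble_le D f g : measurable D -> measurable_fun [set: R] f ->
  (forall x, D x -> `|f x| <= g x) -> intble D g -> intble D f.
Proof.
move=> mD mf fg; apply: le_integrable => //.
  by apply/measurable_EFinP; exact: measurable_funS mf.
by move=> x Dx /=; rewrite lee_fin (le_trans (fg x Dx))// ler_norm.
Qed.

Lemma bdd_cst (t : R) : bdd_measurable (fun=> t : R).
Proof. by split; [exact: measurable_cst|exists `|t|]. Qed.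

Lemma bdd_indic (D : set R) : measurable D -> bdd_measurable (\1_D : R -> R).
Proof.
move=> mD; split; first exact: measurable_indic.
by exists 1 => x; rewrite indicE; case: (x \in D); rewrite ?normr1// normr0.
Qed.

Lemma bdd_measurableD f g : bdd_measurable f -> bdd_measurable g ->
  bdd_measurable (fun x => f x + g x).
Proof.
move=> [mf [M fM]] [mg [N gN]]; split; first exact: measurable_funD.
by exists (M + N) => x; rewrite (le_trans (ler_normD _ _))// lerD.
Qed.

Lemma bdd_measurableM k g : bdd_measurable k -> bdd_measurable g ->
  bdd_measurable (fun x => k x * g x).
Proof.
move=> [mk [M kM]] [mg [N gN]]; split; first exact: measurable_funM.
by exists (M * N) => x; rewrite normrM ler_pM.
Qed.

Lemma bdd_measurableX2 k : bdd_measurable k -> bdd_measurable (fun x => k x ^+ 2).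
Proof. by move=> bk; exact: bdd_measurableM. Qed.

Lemma bdd_measurableZ (a : R) k : bdd_measurable k ->
  bdd_measurable (fun x => a * k x).
Proof.
move=> bk; apply: bdd_measurableM => //; split; first exact: measurable_cst.
by exists `|a|.
Qed.

Lemma intbleM D k f : measurable D -> bdd_measurable k -> intble D f ->
  intble D (fun x => k x * f x).
Proof.
move=> mD [mk [M kM]] fi.
apply: (@integrableMr _ _ _ mu D mD k (EFin \o f)) => //.
  exact: measurable_funS mk.
by exists M; split; [exact: num_real|move=> N MN x _ /=; rewrite (le_trans (kM x))// ltW].
Qed.

Lemma intbleZ D (c : R) f : measurable D -> intble D f ->
  intble D (fun x => c * f x).
Proof. by move=> mD fi; exact: (@integrableZl _ _ _ mu D mD c (EFin \o f)). Qed.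

Lemma intbleD D f g : measurable D -> intble D f -> intble D g ->
  intble D (fun x => f x + g x).
Proof.
by move=> mD; exact: (@integrableD _ _ _ mu D mD (EFin \o f) (EFin \o g)).
Qed.

Lemma intbleB D f g : measurable D -> intble D f -> intble D g ->
  intble D (fun x => f x - g x).
Proof.
by move=> mD; exact: (@integrableB _ _ _ mu D mD (EFin \o f) (EFin \o g)).
Qed.

Lemma intble_setT_locint f : intble setT f -> locint f.
Proof.
move=> fi; split; first by apply/measurable_EFinP; exact: measurable_int fi.
by move=> I; apply: integrableS fi => //; exact: measurable_dset.
Qed.

Lemma locintM k f : bdd_measurable k -> locint f -> locint (fun x => k x * f x).
Proof.
move=> bk [mf fi]; split; first by apply: measurable_funM => //; case: bk.
by move=> I; apply: intbleM => //; exact: measurable_dset.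
Qed.

Lemma locintD f g : locint f -> locint g -> locint (fun x => f x + g x).
Proof.
move=> fi gi; split; first by apply: measurable_funD; [exact: fi.1|exact: gi.1].
by move=> I; apply: intbleD; [exact: measurable_dset|exact: fi.2|exact: gi.2].
Qed.

Lemma locintZ (a : R) f : locint f -> locint (fun x => a * f x).
Proof.
move=> fi; split; first by apply: measurable_funM => //; exact: fi.1.
by move=> I; apply: intbleZ; [exact: measurable_dset|exact: fi.2].
Qed.

Lemma locint_bdd g : bdd_measurable g -> locint g.
Proof.
move=> [mg [M gM]]; split => // I.
apply: (@measurable_bounded_integrable _ _ _ mu g _ (@measurable_dset R I)).
- by have := ltry (dlen R I); rewrite -lebesgue_dset.
- exact: measurable_funS mg.
- by exists M; split; [exact: num_real|move=> N MN x _ /=; rewrite (le_trans (gM x))// ltW].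
Qed.

Lemma RintegralE f : intble setT f ->
  (\int[mu]_x (f x)%:E)%E = (\int[mu]_x f x)%:E.
Proof. by move=> fi; rewrite fineK//; exact: integrable_fin_num. Qed.

Lemma intble_indicM D f : measurable D -> intble D f ->
  intble setT (fun x => \1_D x * f x).
Proof.
move=> mD fi; have := (@integrable_mkcond _ _ _ mu D (EFin \o f) mD).1 fi.
apply: eq_integrable => // x _ /=.
by rewrite patchE indicE; case: (x \in D); rewrite ?mul1r ?mul0r.
Qed.

Lemma Rintegral_indicM (D : set R) f :
  \int[mu]_x (\1_D x * f x) = \int[mu]_(x in D) f x.
Proof.
rewrite [RHS]Rintegral_mkcond; apply: eq_Rintegral => x _.
by rewrite patchE indicE; case: (x \in D); rewrite ?mul1r ?mul0r.
Qed.

Definition dint f I := \int[mu]_(x in dset R I) f x.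

Lemma dint_additive f : locint f -> halves_additive (dint f).
Proof.
move=> [mf fi] I; rewrite /dint.
have E : dset R I = dset R (left_half I) `|` dset R (right_half I).
  by apply/seteqP; split => x /dset_halves.
rewrite {1}E; apply: Rintegral_setU; [exact: measurable_dset|exact: measurable_dset| |].
  by rewrite -E; exact: fi.
apply/disj_setPS => x [/dset_halves_disjoint]; exact.
Qed.

Lemma dintE f J : locint f -> (\int[mu]_(x in dset R J) (f x)%:E)%E = (dint f J)%:E.
Proof.
by move=> fi; rewrite fineK//; apply: integrable_fin_num; [exact: measurable_dset|exact: fi.2].
Qed.

Lemma eq_dint f g I : (forall x, dset R I x -> f x = g x) -> dint f I = dint g I.
Proof. by move=> fg; apply: eq_Rintegral => x /set_mem; exact: fg. Qed.

Lemma le_dint f g I : locint f -> locint g ->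
  (forall x, dset R I x -> f x <= g x) -> dint f I <= dint g I.
Proof.
by move=> fi gi fg; apply: le_Rintegral => //; [exact: measurable_dset|exact: fi.2|exact: gi.2].
Qed.

Lemma dintD f g I : locint f -> locint g ->
  dint (fun x => f x + g x) I = dint f I + dint g I.
Proof.
by move=> fi gi; apply: RintegralD; [exact: measurable_dset|exact: fi.2|exact: gi.2].
Qed.

Lemma dintZ (a : R) f I : locint f -> dint (fun x => a * f x) I = a * dint f I.
Proof. by move=> fi; apply: RintegralZl; [exact: measurable_dset|exact: fi.2]. Qed.

Lemma dint_ge0 f I : (forall x, 0 <= f x) -> 0 <= dint f I.
Proof. by move=> f0; exact: Rintegral_ge0. Qed.

Lemma dint_gt0 f I : locint f -> (forall x, 0 < f x) -> 0 < dint f I.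
Proof.
move=> [mf fi] f0; rewrite lt0r dint_ge0; last by move=> x; exact: ltW.
rewrite andbT; apply/eqP => h0.
have mI := @measurable_dset R I.
have h : (\int[mu]_(x in dset R I) `|(EFin \o f) x| = 0)%E.
  under eq_integral do rewrite /= gtr0_norm//.
  rewrite -(fineK (integrable_fin_num mI (fi I))).
  by congr EFin; exact: h0.
have mfI : measurable_fun (dset R I) (EFin \o f).
  by apply/measurable_EFinP; exact: measurable_funS mf.
have := (ae_eq_integral_abs mu mI mfI).1 h; move=> [N [mN N0 sub]].
have : (mu (dset R I) <= mu N)%E.
  rewrite le_measure ?inE// => x Ix; apply: sub => /= /(_ Ix) [] fx.
  by have := f0 x; rewrite fx ltxx.
by rewrite N0 lebesgue_dset lee_fin leNgt dlen_gt0.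
Qed.

Lemma dint_norm_le f I : locint f -> `|dint f I| <= dint (fun x => `|f x|) I.
Proof.
by move=> [mf fi]; apply: le_normr_Rintegral; [exact: measurable_dset|exact: fi].
Qed.

Lemma locint_norm f : locint f -> locint (fun x => `|f x|).
Proof.
move=> [mf fi]; split; first exact: measurableT_comp.
by move=> I; apply: integrable_norm; exact: fi.
Qed.

(** Stated for f ^ 2 <= w g, so that it applies both to f = w^(1/2) u, g = u ^
2 and to f = w u, g = w u ^ 2. Proof by optimizing t in 2 |f| <= t w + g / t.
*)
Lemma dint_cauchy_schwarz f g w I : locint f -> locint g -> locint w ->
  (forall x, 0 < w x) -> (forall x, f x ^+ 2 <= w x * g x) ->
  0 < dint w I ->
  dint (fun x => `|f x|) I ^+ 2 <= dint w I * dint g I.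
Proof.
move=> fi gi wi w0 fg W0.
have mI := @measurable_dset R I.
set P := dint (fun x => `|f x|) I.
have P0 : 0 <= P by exact: dint_ge0.
have H t : 0 < t -> 2 * P <= t * dint w I + t^-1 * dint g I.
  move=> t0; rewrite /P /dint.
  have nfi := (locint_norm fi).2 I; have {}gi := gi.2 I; have {}wi := wi.2 I.
  rewrite -!RintegralZl// -RintegralD//; [|exact: intbleZ|exact: intbleZ].
  apply: le_Rintegral => //; [exact: intbleZ|by apply: intbleD => //; exact: intbleZ|].
  move=> x _.
  have := weighted_amgm 1 `|f x| (mulr_gt0 t0 (w0 x)); rewrite mul1r expr1n mulr1.
  move=> /le_trans; apply; rewrite lerD2l invfM mulrCA.
  rewrite ler_pM2l ?invr_gt0// real_normK ?num_real//.
  by rewrite ler_pdivrMr// mulrC.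
have [Pz|Pn0] := eqVneq P 0.
  rewrite Pz expr0n /= mulr_ge0 ?(ltW W0)//; apply: dint_ge0 => x.
  by rewrite -(pmulr_rge0 _ (w0 x)) (le_trans _ (fg x)) ?sqr_ge0.
have Pp : 0 < P by rewrite lt0r Pn0.
have := H (P / dint w I) (divr_gt0 Pp W0).
rewrite divfK ?gt_eqF// invf_div.
have -> : dint w I / P * dint g I = (dint w I * dint g I) / P by rewrite mulrAC.
rewrite -lerBlDl (_ : 2 * P - P = P); last by ring.
by rewrite ler_pdivlMr.
Qed.

Lemma haar_mul f I x : f x * haar I x = (Num.sqrt (dlen R I))^-1 *
   (\1_(dset R (left_half I)) x * f x - \1_(dset R (right_half I)) x * f x).
Proof. by rewrite /haar; ring. Qed.

Lemma bdd_haar I : bdd_measurable (@haar R I).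
Proof.
split.
  by apply: measurable_funB; apply: measurable_funM => //; apply: measurable_indic;
    exact: measurable_dset.
exists (Num.sqrt (dlen R I))^-1 => x.
have [/dset_halves[h|h]|h] := pselect (dset R I x).
- by rewrite haar_left// ger0_norm.
- by rewrite haar_right// normrN ger0_norm.
- by rewrite haar_out// normr0.
Qed.

Lemma intble_haar f I : locint f -> intble setT (fun x => haar I x * f x).
Proof.
move=> [mf fi].
have := intbleM measurableT (bdd_haar I)
  (intble_indicM (@measurable_dset R I) (fi I)).
apply: eq_integrable => // x _ /=; rewrite indicE.
have [h|h] := pselect (dset R I x); first by rewrite mem_set// mul1r.
by rewrite haar_out ?mul0r.
Qed.

Lemma pairing_haar f I : locint f ->
  pairing f (haar I) = delta (dint f) I / Num.sqrt (dlen R I).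
Proof.
move=> [mf fi]; rewrite /pairing mulrC /delta.
under eq_Rintegral do rewrite haar_mul.
have li J := intble_indicM (@measurable_dset R J) (fi J).
rewrite RintegralZl//; last exact: intbleB.
by rewrite RintegralB ?Rintegral_indicM//; exact: li.
Qed.

Lemma pairing_mul f g I : locint f -> locint g ->
  pairing f (haar I) * pairing g (haar I) =
  delta (dint f) I * delta (dint g) I / dlen R I.
Proof.
move=> fi gi; rewrite !pairing_haar// mulrACA sqrt_dlenK//.
Qed.

Lemma pairingZ (t : R) phi I : locint phi ->
  pairing (fun x => t * phi x) (haar I) = t * pairing phi (haar I).
Proof.
move=> phii; rewrite -RintegralZl//; last first.
  apply: eq_integrable (intble_haar I phii) => // x _ /=; by rewrite mulrC.
by apply: eq_Rintegral => x _; rewrite mulrA.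
Qed.

Definition haar_comb (l : seq dyadic) (c : dyadic -> R) (x : R) :=
  \sum_(I <- l) c I * haar I x.

Lemma bdd_haar_comb l c : bdd_measurable (haar_comb l c).
Proof.
split.
  apply: measurable_sum => I; apply: measurable_funM => //.
  by have [] := bdd_haar I.
elim: l => [|I l [M IH]]; first by exists 0 => x; rewrite /haar_comb big_nil normr0.
have [_ [N hN]] := bdd_haar I.
exists (`|c I| * N + M) => x; rewrite /haar_comb big_cons.
apply: le_trans (ler_normD _ _) _; apply: lerD; last exact: IH.
by rewrite normrM ler_wpM2l.
Qed.

Lemma intble_haar_comb l c f : locint f ->
  intble setT (fun x => haar_comb l c x * f x).
Proof.
move=> fi; have := @integrable_sum _ _ _ mu setT measurableT _ l xpredT
  (fun I => EFin \o (fun x => c I * (haar I x * f x))).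
move=> /(_ (fun I _ => integrableZl measurableT (c I) (intble_haar I fi))).
apply: eq_integrable => // x _ /=; rewrite sumEFin; congr EFin.
by rewrite /haar_comb mulr_suml; apply: eq_bigr => I _; rewrite mulrA.
Qed.

Lemma Rintegral_haar_comb l c f : locint f ->
  \int[mu]_x (haar_comb l c x * f x) = \sum_(I <- l) c I * pairing f (haar I).
Proof.
move=> fi; elim: l => [|I l IH].
  rewrite big_nil; under eq_Rintegral do rewrite /haar_comb big_nil mul0r.
  by rewrite Rintegral_cst// mul0r.
rewrite big_cons -IH.
have -> : pairing f (haar I) = \int[mu]_x (haar I x * f x).
  by apply: eq_Rintegral => x _; rewrite mulrC.
have hi := intble_haar I fi; have ci := intble_haar_comb l c fi.
rewrite -RintegralZl// -RintegralD//; last exact: intbleZ.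
by apply: eq_Rintegral => x _; rewrite /haar_comb big_cons; ring.
Qed.

End Integrals.

(** * Consequences of testing: A2, square function, duality *)

Section Testing.
Context {R : realType}.
Notation mu := (@lebesgue_measure R).
Implicit Types (I J : dyadic) (f g k phi psi w v : R -> R) (l : seq dyadic)
  (s c : dyadic -> R).

Definition unimodular s := forall I, s I = 1 \/ s I = -1.

(** The testing condition for finite Haar sums of chi_J w; the list l may
contain intervals larger than J. *)
Definition fin_test w v (C : R) := forall J l s, uniq l -> unimodular s ->
  dint (fun x => haar_comb l (fun I => s I * pairing (restrict_dyadic J w) (haar I)) x ^+ 2
                 * v x) J <= C * dint w J.

Lemma pairing_restrict J w I : (forall x, dset R I x -> dset R J x) ->
  pairing (restrict_dyadic J w) (haar I) = pairing w (haar I).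
Proof.
move=> IJ; apply: eq_Rintegral => x _; rewrite /restrict_dyadic.
have [h|h] := pselect (dset R I x); last by rewrite haar_out// !mulr0.
by rewrite indicE mem_set ?mul1r//; exact: IJ.
Qed.

(** On the left half J of I, the Haar sum reduced to the interval I is the
constant w(J) / |I|, so its square norm over J is w(J) ^ 2 v(J) / |I| ^ 2. *)
Lemma fin_test_A2 w v C I : locint w -> locint v -> (forall x, 0 < w x) ->
  fin_test w v C ->
  dint w (left_half I) * dint v (left_half I) <= C * dlen R I ^+ 2.
Proof.
move=> wi vi w0 test; set J := left_half I.
have W0 := dint_gt0 J wi w0.
have u1 : unimodular (fun=> 1) by left.
have := test J [:: I] (fun=> 1) isT u1.
rewrite (_ : dint _ J = (dint w J / dlen R I) ^+ 2 * dint v J); last first.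
  rewrite -dintZ//; apply: eq_dint => x Jx; congr (_ ^+ 2 * _).
  rewrite /haar_comb big_seq1 mul1r haar_left//.
  have -> : pairing (restrict_dyadic J w) (haar I) =
            (Num.sqrt (dlen R I))^-1 * dint w J.
    rewrite -dintZ// /pairing /dint -(Rintegral_indicM (dset R J)); apply: eq_Rintegral => y _.
    rewrite /restrict_dyadic indicE.
    have [h|h] := pselect (dset R J y); last by rewrite memNset// !mul0r.
    by rewrite mem_set// !mul1r haar_left// mulrC.
  by rewrite mulrAC sqrt_dlenK mulrC.
have l0 := @dlen_gt0 R I.
rewrite exprMn exprVn mulrAC ler_pdivrMr ?exprn_gt0// => h.
by rewrite -(ler_pM2l W0); lra.
Qed.

(** Adding one term at a time, one of the two signs makes the cross term with
the sum already formed nonnegative. *)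
Lemma sign_choice l c v J : uniq l -> locint v ->
  exists2 s, unimodular s &
    \sum_(I <- l) dint (fun x => (c I * haar I x) ^+ 2 * v x) J <=
    dint (fun x => haar_comb l (fun I => s I * c I) x ^+ 2 * v x) J.
Proof.
move=> + vi; elim: l => [_|I l IH /= /andP[Il ul]].
  exists (fun=> 1); first by left.
  by rewrite big_nil; apply: Rintegral_ge0 => x _; rewrite /haar_comb big_nil expr0n mul0r.
have [s us Hs] := IH ul.
pose F := haar_comb l (fun I => s I * c I).
pose h x := c I * haar I x.
have bF : bdd_measurable F by exact: bdd_haar_comb.
have bh : bdd_measurable h by exact/bdd_measurableZ/bdd_haar.
pose B := dint (fun x => F x * h x * v x) J.
pose e : R := if 0 <= B then 1 else -1.
have e2 : e ^+ 2 = 1 by rewrite /e; case: ifP; rewrite ?sqrrN expr1n.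
have eB : 0 <= e * B.
  rewrite /e; case: ifPn => [hB|]; first by rewrite mul1r.
  by rewrite -ltNge => /ltW hB; rewrite mulN1r oppr_ge0.
exists (fun K => if K == I then e else s K).
  move=> K; case: eqP => _; last exact: us.
  by rewrite /e; case: ifP; [left|right].
rewrite big_cons.
have -> : dint (fun x => haar_comb (I :: l)
    (fun K => (if K == I then e else s K) * c K) x ^+ 2 * v x) J =
  dint (fun x => h x ^+ 2 * v x + (F x ^+ 2 * v x + (2 * e) * (F x * h x * v x))) J.
  apply: eq_dint => x _; rewrite /haar_comb big_cons eqxx.
  have -> : \sum_(j <- l) (if j == I then e else s j) * c j * haar j x = F x.
    apply: eq_big_seq => K Kl; case: eqP => // KI.
    by move: Il; rewrite -KI Kl.
  rewrite -mulrA -/(h x).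
  transitivity (e ^+ 2 * (h x ^+ 2 * v x) +
    (F x ^+ 2 * v x + 2 * e * (F x * h x * v x))); first by ring.
  by rewrite e2 mul1r.
have i1 : locint (fun x => h x ^+ 2 * v x) by apply: locintM => //; exact: bdd_measurableX2.
have i2 : locint (fun x => F x ^+ 2 * v x) by apply: locintM => //; exact: bdd_measurableX2.
have i3 : locint (fun x => F x * h x * v x) by apply: locintM => //; exact: bdd_measurableM.
have i4 := locintZ (2 * e) i3.
rewrite dintD//; last exact: locintD.
rewrite dintD// dintZ// lerD2l (le_trans Hs)// lerDl -mulrA mulr_ge0//.
Qed.

Lemma dint_haar_sqr (a : R) v I J : locint v ->
  (forall x, dset R I x -> dset R J x) ->
  dint (fun x => (a * haar I x) ^+ 2 * v x) J = a ^+ 2 / dlen R I * dint v I.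
Proof.
move=> vi IJ; rewrite -dintZ//.
rewrite /dint -(Rintegral_indicM (dset R I)) -(Rintegral_indicM (dset R J)).
apply: eq_Rintegral => x _; rewrite !indicE.
have [h|h] := pselect (dset R I x); last first.
  by rewrite haar_out// (memNset h) mulr0 expr0n !mul0r mulr0.
rewrite (mem_set h) (mem_set (IJ _ h)) !mul1r exprMn; congr (_ * _ * _).
move/dset_halves : h => [h|h]; first by rewrite (haar_left h) expr2 sqrt_dlenK.
by rewrite (haar_right h) sqrrN expr2 sqrt_dlenK.
Qed.

Lemma fin_test_square w v C n J : locint w -> locint v -> fin_test w v C ->
  \sum_(I <- desc n J) square_coef (dlen R) (dint w) (dint v) I <= C * dint w J.
Proof.
move=> wi vi test.
have [s us Hs] := @sign_choice _ (fun I => pairing (restrict_dyadic J w) (haar I))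
  _ J (@desc_uniq R n J) vi.
apply: le_trans (test J _ s (@desc_uniq R n J) us); apply: le_trans Hs.
rewrite big_seq [leRHS]big_seq; apply: ler_sum => I Id.
have IJ x : dset R I x -> dset R J x by exact: desc_sub Id.
rewrite dint_haar_sqr// pairing_restrict// pairing_haar//.
rewrite /square_coef !exprMn !exprVn sqr_sqrtr ?(ltW (dlen_gt0 _))//.
have -> : (dlen R I ^+ 2)^-1 = (dlen R I)^-1 * (dlen R I)^-1.
  by rewrite expr2 invfM.
by rewrite !mulrA.
Qed.

(** With signs making every term nonnegative the left side is the integral
over J of S g v, S being a Haar sum estimated by testing. *)
Lemma fin_test_dual w v C g n J : locint w -> locint v -> (forall x, 0 < v x) ->
  fin_test w v C -> bdd_measurable g ->
  \sum_(I <- desc n J) `|delta (dint w) I * delta (dint (fun x => g x * v x)) I|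
     / dlen R I <=
  C * dint w J + dint (fun x => g x ^+ 2 * v x) J.
Proof.
move=> wi vi v0 test bg.
set psi := fun x => g x * v x.
have psii : locint psi by exact: locintM.
pose e I : R := if 0 <= delta (dint w) I * delta (dint psi) I then 1 else -1.
have ue : unimodular e by move=> I; rewrite /e; case: ifP; [left|right].
pose c I := pairing (restrict_dyadic J w) (haar I).
pose S := haar_comb (desc n J) (fun I => e I * c I).
have bS : bdd_measurable S by exact: bdd_haar_comb.
have i1 : locint (fun x => S x ^+ 2 * v x) by apply: locintM => //; exact: bdd_measurableX2.
have i2 : locint (fun x => g x ^+ 2 * v x) by apply: locintM => //; exact: bdd_measurableX2.
rewrite (_ : \sum_(I <- _) _ = \int[mu]_x (S x * psi x)); last first.
  rewrite Rintegral_haar_comb// big_seq [RHS]big_seq; apply: eq_bigr => I Id.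
  rewrite /c pairing_restrict; last by move=> x; exact: desc_sub Id.
  rewrite -mulrA pairing_mul// mulrA; congr (_ / _).
  rewrite /e; case: ifPn => h; first by rewrite mul1r ger0_norm.
  by rewrite mulN1r ler0_norm// ltW// ltNge.
rewrite (_ : \int[mu]_x _ = dint (fun x => S x * psi x) J); last first.
  rewrite /dint -(Rintegral_indicM (dset R J)); apply: eq_Rintegral => x _; rewrite indicE.
  have [h|h] := pselect (dset R J x); first by rewrite mem_set// mul1r.
  rewrite memNset// mul0r /S /haar_comb big_seq big1 ?mul0r// => I Id.
  by rewrite haar_out ?mulr0// => /(desc_sub Id).
apply: le_trans (lerD (test J _ e (@desc_uniq R n J) ue) (lexx _)).
rewrite -dintD//; apply: le_dint => [||x _]; [exact: locintM|exact: locintD|].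
have vx := ltW (v0 x).
rewrite -/c -/(S x) -mulrDl /psi mulrA ler_wpM2r//.
by have := sqr_ge0 (S x - g x); have := sqr_ge0 (S x); have := sqr_ge0 (g x); nra.
Qed.

End Testing.

(** * The bilinear estimate from testing *)

Section Sufficiency.
Context {R : realType}.
Notation mu := (@lebesgue_measure R).
Implicit Types (I J : dyadic) (f g k phi psi w v F G : R -> R) (l : seq dyadic)
  (s c a b : dyadic -> R).

Definition step_comb l b (x : R) := \sum_(I <- l) b I * \1_(dset R I) x.

Lemma bdd_step_comb l b : bdd_measurable (step_comb l b).
Proof.
elim: l => [|I l IH].
  by have := bdd_cst (0 : R); congr bdd_measurable; apply/funext => x; rewrite /step_comb big_nil.
have := bdd_measurableD (bdd_measurableZ (b I) (bdd_indic (@measurable_dset R I))) IH.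
by congr bdd_measurable; apply/funext => x; rewrite /step_comb big_cons.
Qed.

Lemma step_comb_out n J b x : ~ dset R J x -> step_comb (desc n J) b x = 0.
Proof.
move=> Jx; rewrite /step_comb big_seq big1// => I Id.
by rewrite indicE memNset ?mulr0// => /(desc_sub Id).
Qed.

Lemma dint_step_comb l b f J : locint f ->
  (forall I x, I \in l -> dset R I x -> dset R J x) ->
  dint (fun x => step_comb l b x * f x) J = \sum_(I <- l) b I * dint f I.
Proof.
move=> fi; elim: l => [|I l IH] IJ.
  rewrite big_nil (@eq_dint _ _ (fun x => 0 * f x)); last first.
    by move=> x _; rewrite /step_comb big_nil.
  by rewrite dintZ// mul0r.
rewrite big_cons -IH; last by move=> K x Kl; apply: IJ; rewrite inE Kl orbT.
have -> : dint f I = dint (fun x => \1_(dset R I) x * f x) J.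
  rewrite /dint -(Rintegral_indicM (dset R I)) -(Rintegral_indicM (dset R J)).
  apply: eq_Rintegral => x _; rewrite !indicE.
  have [h|h] := pselect (dset R I x); last by rewrite (memNset h) !mul0r mulr0.
  by rewrite (mem_set h) mem_set ?mul1r//; apply: IJ h; rewrite mem_head.
have i1 : locint (fun x => \1_(dset R I) x * f x).
  by apply: locintM => //; apply: bdd_indic; exact: measurable_dset.
have i2 : locint (fun x => step_comb l b x * f x).
  by apply: locintM => //; exact: bdd_step_comb.
rewrite -dintZ// -dintD//; last exact: locintZ.
by apply: eq_dint => x _; rewrite /step_comb big_cons; ring.
Qed.

Lemma stack_norm2_dint v a n J (t : R) : locint v ->
  stack_norm2 (dint v) a n J t =
  dint (fun x => (t + step_comb (desc n J) (fun I => a I / dint v I) x) ^+ 2 * v x) J.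
Proof.
move=> vi; elim: n J t => [|n IH] J t /=.
  rewrite -dintZ//; apply: eq_dint => x _.
  by rewrite /step_comb big_nil addr0.
rewrite !IH [RHS]dint_additive; last first.
  apply: locintM => //; apply/bdd_measurableX2/bdd_measurableD.
    exact: bdd_cst.
  exact: (bdd_step_comb (desc n.+1 J)).
congr (_ + _); apply: eq_dint => x xI; congr (_ ^+ 2 * _);
  rewrite -[in RHS]/(desc n.+1 J) /step_comb sum_descS indicE mem_set ?mulr1;
  do ?[by apply/dset_halves; left|by apply/dset_halves; right];
  rewrite -!/(step_comb (desc n _) (fun I => a I / dint v I) x) addrA.
  rewrite [X in _ + (_ + X)]step_comb_out ?addr0// => h.
  exact: dset_halves_disjoint xI h.
rewrite [X in _ + (X + _)]step_comb_out ?add0r// => h.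
exact: dset_halves_disjoint h xI.
Qed.

(** Apply the dual form of testing to g = t Gamma, where Gamma is the sum of
(a I / V I) chi_I: the pairing of Gamma with g v is t times the square norm
sought, the correction between the coefficients of g v and those of v times
the mean of g is a martingale difference handled by orthogonality and the
square function, and a small t absorbs the quadratic error. *)
Lemma fin_test_stack w v C n J : locint w -> locint v ->
  (forall x, 0 < w x) -> (forall x, 0 < v x) -> fin_test w v C ->
  stack_norm2 (dint v) (cross_coef (dint w) (dint v) (dlen R)) n J 0 <=
  16 * C * dint w J.
Proof.
move=> wi vi w0 v0 test; rewrite stack_norm2_dint//.
set a := cross_coef _ _ _; set V := dint v; set W := dint w.
have V0 I : 0 < V I by exact: dint_gt0.
have Vadd : halves_additive V by exact: dint_additive.
set b := fun I => a I / V I.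
set Gam := step_comb (desc n J) b.
have bG : bdd_measurable Gam by exact: bdd_step_comb.
have -> : dint (fun x => (0 + Gam x) ^+ 2 * v x) J = dint (fun x => Gam x ^+ 2 * v x) J.
  by apply: eq_dint => x _; rewrite add0r.
set T := dint _ J.
(* with this t the quadratic error 2 t ^ 2 T is half of the gain t T *)
pose t : R := 4^-1.
pose g x := t * Gam x.
have bg : bdd_measurable g by exact: bdd_measurableZ.
pose Q := dint (fun x => g x * v x).
have gi : locint (fun x => g x * v x) by exact: locintM.
have Qadd : halves_additive Q by exact: dint_additive.
have g2i : locint (fun x => g x ^+ 2 * v x).
  by apply: locintM => //; exact: bdd_measurableX2.
have Gi : locint (fun x => Gam x ^+ 2 * v x).
  by apply: locintM => //; exact: bdd_measurableX2.
pose G := dint (fun x => g x ^+ 2 * v x).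
have GE : G J = t ^+ 2 * T.
  by rewrite /G /T -dintZ//; apply: eq_dint => x _; rewrite /g; ring.
have QG I : Q I ^+ 2 <= V I * G I.
  apply: le_trans (_ : dint (fun x => `|g x * v x|) I ^+ 2 <= _).
    rewrite -(@real_normK _ (Q I)) ?num_real// ler_sqr ?nnegrE//.
      exact: dint_norm_le.
    exact: dint_ge0.
  apply: dint_cauchy_schwarz => //.
  by move=> x; rewrite exprMn expr2 [v x ^+ 2]expr2 [leLHS]mulrCA -expr2 mulrA.
have tT : t * T = \sum_(I <- desc n J) b I * Q I.
  rewrite -(@dint_step_comb _ _ _ J)//; last by move=> I x; exact: desc_sub.
  by rewrite /T -dintZ//; apply: eq_dint => x _; rewrite /g -/Gam; ring.
have dual := fin_test_dual n J wi vi v0 test bg.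
have sq := fin_test_square n J wi vi test.
have va := sum_var_le n J V0 (dint_additive g2i) QG.
suff : t * T <= (C * W J + G J) + (C * W J + G J) by rewrite GE /t; lra.
rewrite tT; apply: le_trans (lerD dual (lerD sq va)).
rewrite -!big_split /=; apply: ler_sum => I _.
have [d1 _] := sqr_martingale_diff_le I V0 Vadd Qadd.
set d := _ - _ in d1.
have := mixed_term_le (delta W I) 1 (@dlen_gt0 R I) (V0 I) d1.
rewrite mulr1 expr1n mulr1 => h; rewrite /square_coef.
apply: le_trans (lerD (lexx _) h).
have -> : b I * Q I = `|delta W I * delta V I| * (Q I / V I) / dlen R I.
  by rewrite /b /a /cross_coef; ring.
rewrite -mulrDl ler_wpM2r ?invr_ge0 ?(ltW (@dlen_gt0 R I))//.
apply: le_trans (_ : `|delta W I * delta V I * (Q I / V I)| <= _).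
  by rewrite [leRHS]normrM; apply: ler_wpM2l => //; exact: ler_norm.
have -> : delta W I * delta V I * (Q I / V I) = delta W I * delta Q I - delta W I * d.
  by rewrite /d; ring.
exact: ler_normB.
Qed.

Definition test_const (C : R) := bilinear_const C (16 * C).

Lemma fin_test_bilinear w v C phi psi F G n J : locint w -> locint v ->
  (forall x, 0 < w x) -> (forall x, 0 < v x) -> 0 < C ->
  fin_test w v C -> fin_test v w C ->
  locint phi -> locint psi -> locint F -> locint G ->
  (forall x, phi x ^+ 2 <= w x * F x) -> (forall x, psi x ^+ 2 <= v x * G x) ->
  \sum_(I <- desc n J) `|pairing phi (haar I) * pairing psi (haar I)| <=
  test_const C * (dint F J + dint G J).
Proof.
move=> wi vi w0 v0 C0 tw tv phii psii Fi Gi pF pG.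
have W0 I := dint_gt0 I wi w0; have V0 I := dint_gt0 I vi v0.
have Wle I U : 0 < dint U I -> C * dint U I <= 16 * C * dint U I.
  by move=> h; have := mulr_gt0 C0 h; lra.
rewrite (eq_bigr (fun I => `|delta (dint phi) I * delta (dint psi) I| / dlen R I));
  last first.
  by move=> I _; rewrite pairing_mul// normrM normfV (gtr0_norm (@dlen_gt0 R I)).
have cc : cross_coef (dint v) (dint w) (dlen R) = cross_coef (dint w) (dint v) (dlen R).
  by apply/funext => I; rewrite /cross_coef [delta (dint v) I * _]mulrC.
apply: (@bilinear_embedding _ (dint w) (dint v) (dlen R) C (16 * C) _ _ _ _ _ _ _ _ _ _ _ _
  _ (dint (fun x => `|phi x|)) _ (dint (fun x => `|psi x|))) => //.
all: try exact: dint_additive.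
all: try (by apply: dint_additive; exact: locint_norm).
all: try (by move=> I; exact: dint_norm_le).
all: try (by move=> I; exact: dint_cauchy_schwarz).
- exact: dlen_gt0.
- exact: ltW.
- by rewrite mulr_gt0.
- by move=> I; exact: fin_test_A2.
- by move=> m I; apply: le_trans (Wle _ _ (W0 I)); exact: fin_test_square.
- by move=> m I; apply: le_trans (Wle _ _ (V0 I)); exact: fin_test_square.
- by move=> m I; exact: fin_test_stack.
- by move=> m I; rewrite -cc; exact: fin_test_stack.
Qed.

End Sufficiency.

(** * Pointwise Haar series *)

Section Convergence.
Context {R : realType}.
Notation mu := (@lebesgue_measure R).
Implicit Types (I J K : dyadic) (f phi psi w v : R -> R) (l : seq dyadic)
  (s c : dyadic -> R).

Lemma limn_esup_einf_cvg (u : nat -> R) (a : R) :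
  limn_esup (EFin \o u) = a%:E -> limn_einf (EFin \o u) = a%:E -> u @ \oo --> a.
Proof.
move=> us ui.
have : (EFin \o u) @ \oo --> a%:E.
  apply: (@squeeze_cvge _ _ _ _ (einfs (EFin \o u)) _ (esups (EFin \o u))).
  - apply: nearW => n; apply/andP; split.
      by apply: ereal_inf_lbound; exists n => //=.
    by apply: ereal_sup_ubound; exists n => //=.
  - rewrite -ui limn_einf_lim; exact: is_cvg_einfs.
  - rewrite -us limn_esup_lim; exact: is_cvg_esups.
by move=> /fine_cvg.
Qed.

(** Convergence holds exactly where the upper and lower limits are equal and
finite, and elsewhere the value of the limit is 0. *)
Lemma measurable_fun_limn (h : nat -> R -> R) :
  (forall n, measurable_fun [set: R] (h n)) ->
  measurable_fun [set: R] (fun x => limn (fun n => h n x)).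
Proof.
move=> mh.
pose E x := limn_esup (EFin \o h^~ x); pose e x := limn_einf (EFin \o h^~ x).
pose b x := (E x == e x) && (E x \is a fin_num).
have mE : measurable_fun [set: R] E.
  by apply: (@measurable_fun_limn_esup _ _ _ _ (fun n x => (h n x)%:E)) => n;
    apply/measurable_EFinP.
have me : measurable_fun [set: R] e.
  apply: measurableT_comp => //.
  by apply: (@measurable_fun_limn_esup _ _ _ _ (fun n x => - (h n x)%:E)%E) => n;
    apply: measurableT_comp => //; apply/measurable_EFinP.
have limE x : limn (fun n => h n x) = if b x then fine (E x) else 0.
  case: ifPn => [/andP[/eqP Ee Ef]|bx].
    apply/cvg_lim => //; apply: limn_esup_einf_cvg.
      by rewrite fineK.
    by rewrite fineK.
  apply: dvgP => /cvg_ex[l hl]; move/negP: bx; apply.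
  have hl' : (EFin \o h^~ x) @ \oo --> l%:E by apply: cvg_EFin => //; exact: nearW.
  have [e1 e2] := cvg_limn_einf_sup hl'.
  by rewrite /b /E /e e1 e2 eqxx.
rewrite (_ : (fun x => _) = (fun x => if b x then fine (E x) else 0)); last first.
  exact/funext.
apply: measurable_fun_ifT => //; last exact: measurableT_comp.
apply: measurable_and.
  apply: (measurable_fun_bool true).
  have := measurable_eqe measurableT mE me; congr measurable.
  by apply/seteqP; split => x [_ h1]; split => //; apply/eqP.
apply: (measurable_fun_bool true).
exact: emeasurable_fin_num.
Qed.

Definition window_sum s phi N (x : R) :=
  haar_comb (window N) (fun I => s I * pairing phi (haar I)) x.

(** Any given point lies in the range covered by the window from some order
on. *)
Lemma haar_multiplierE s phi x :
  haar_multiplier s phi x = limn (fun N => window_sum s phi N x).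
Proof.
rewrite /haar_multiplier /lim /lim_in; congr (get _); apply/funext => l.
have H : \forall N \near \oo, haar_partial_sum s phi N x = window_sum s phi N x.
  by have := near_window x; apply: filterS => N; exact: partial_sum_window.
rewrite propeqE; split; apply: cvg_trans; apply: near_eq_cvg => //.
by apply: filterS H.
Qed.

Lemma measurable_haar_multiplier s phi :
  measurable_fun [set: R] (haar_multiplier s phi).
Proof.
rewrite (_ : haar_multiplier s phi = fun x => limn (fun N => window_sum s phi N x)).
  apply: measurable_fun_limn => n; by have [] := bdd_haar_comb (window n)
    (fun I => s I * pairing phi (haar I)).
by apply/funext => x; exact: haar_multiplierE.
Qed.

Lemma eq_haar_multiplier s phi psi :
  (forall I, pairing phi (haar I) = pairing psi (haar I)) ->
  haar_multiplier s phi = haar_multiplier s psi.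
Proof.
move=> e; apply/funext => x; rewrite !haar_multiplierE; congr (limn _).
by apply/funext => N; rewrite /window_sum; under eq_fun do rewrite e.
Qed.

(** Where the series diverges the integrand on the left is 0, hence still
below the lower limit. *)
Lemma haar_multiplier_fatou (D : set (measurableTypeR R)) s phi v (M : \bar R) :
  measurable D -> measurable_fun [set: R] v -> (forall x, 0 <= v x) ->
  (forall N, (\int[mu]_(x in D) (window_sum s phi N x ^+ 2 * v x)%:E <= M)%E) ->
  (\int[mu]_(x in D) (haar_multiplier s phi x ^+ 2 * v x)%:E <= M)%E.
Proof.
move=> mD mv v0 H.
pose g N (x : R) := (window_sum s phi N x ^+ 2 * v x)%:E.
have mS N : measurable_fun [set: R] (window_sum s phi N).
  by have [] := bdd_haar_comb (window N) (fun I => s I * pairing phi (haar I)).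
have mg N : measurable_fun D (g N).
  apply: measurable_funTS; apply/measurable_EFinP.
  have h : measurable_fun [set: R] (fun x => window_sum s phi N x ^+ 2 * v x).
    by apply: measurable_funM => //; exact: measurable_funX.
  exact: h.
have g0 N x : D x -> (0 <= g N x)%E by rewrite lee_fin mulr_ge0// sqr_ge0.
apply: (@le_trans _ _ (\int[mu]_(x in D) limn_einf (g^~ x))%E); last first.
  apply: le_trans (fatou mu mD mg g0) _; rewrite limn_einf_lim.
  apply: lime_le; first exact: is_cvg_einfs.
  by apply: nearW => n; apply: le_trans (H n); apply: ereal_inf_lbound; exists n => /=.
apply: ge0_le_integral => //.
- by move=> x _; rewrite lee_fin mulr_ge0// sqr_ge0.
- apply: measurable_funTS; apply/measurable_EFinP.
  have h : measurable_fun [set: R] (fun x => haar_multiplier s phi x ^+ 2 * v x).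
    by apply: measurable_funM => //; apply: measurable_funX; exact: measurable_haar_multiplier.
  exact: h.
- apply: measurableT_comp => //.
  by apply: measurable_fun_limn_esup => n; exact: measurableT_comp.
move=> x Dx; rewrite haar_multiplierE.
have [cv|dv] := pselect (cvgn (fun N => window_sum s phi N x)); last first.
  rewrite dvgP// expr0n mul0r limn_einf_lim; apply: lime_ge; first exact: is_cvg_einfs.
  apply: nearW => n; apply: le_ereal_inf_tmp => _ [m _ <-]; exact: g0.
suff /cvg_limn_einf_sup[-> _] : g^~ x @ \oo -->
  (limn (fun N => window_sum s phi N x) ^+ 2 * v x)%:E by [].
apply: cvg_EFin; first exact: nearW.
apply: cvgM; last exact: cvg_cst.
by rewrite expr2; apply: cvgM.
Qed.

End Convergence.

(** * Almost everywhere convergence for constant signs *)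

Section Averaging.
Context {R : realType}.
Notation mu := (@lebesgue_measure R).
Implicit Types (I J K : dyadic) (f phi psi w v : R -> R) (l : seq dyadic)
  (s c : dyadic -> R).

Definition dyadic_at (k : int) (x : R) : dyadic := (k, Num.floor (x / 2 ^ k)).

Lemma dset_dyadic_at k x : dset R (dyadic_at k x) x.
Proof.
have l0 : 0 < (2 ^ k : R) by rewrite exprz_gt0.
apply/dsetE; rewrite /dlen /=; split.
  by rewrite -ler_pdivlMr// floor_le_tmp.
by rewrite -ltr_pdivrMr// -intrD1 floorD1_gt.
Qed.

Lemma ae_impl (P Q : R -> Prop) : (forall x, P x -> Q x) ->
  {ae mu, forall x, P x} -> {ae mu, forall x, Q x}.
Proof.
move=> PQ [N [mN N0 sub]]; exists N; split => //.
by apply: subset_trans sub => x /=; exact/contra_not/PQ.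
Qed.

Definition mean phi I := dint phi I / dlen R I.

Lemma sum_haar_out n J c (x : R) : ~ dset R J x ->
  \sum_(I <- desc n J) c I * haar I x = 0.
Proof.
move=> Jx; rewrite big_seq big1// => I Id.
by rewrite haar_out ?mulr0// => /(desc_sub Id).
Qed.

(** At a point of the left half of J, the term of J is the mean over that half
minus the mean over J; similarly on the right. *)
Lemma haar_expansion_telescopes phi n J K x : locint phi ->
  dset R J x -> dset R K x -> K.1 = J.1 - n%:Z ->
  \sum_(I <- desc n J) pairing phi (haar I) * haar I x = mean phi K - mean phi J.
Proof.
move=> phii; have Padd := dint_additive phii.
elim: n J => [|n IH] J Jx Kx KJ.
  rewrite sum_desc0 (@dset_scale_inj R K J x) ?subrr//.
  by rewrite KJ subr0.
have l0 := @dlen_gt0 R J.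
rewrite sum_descS pairing_haar// /mean (Padd J).
have [h|h] : dset R (left_half J) x \/ dset R (right_half J) x by apply/dset_halves.
  rewrite (IH (left_half J))//; last by rewrite KJ /=; lia.
  rewrite [X in _ + (_ + X)]sum_haar_out//; last first.
    by move=> hr; exact: dset_halves_disjoint h hr.
  rewrite (haar_left h) -mulrA sqrt_dlenK /mean dlen_left_half /delta.
  by field; rewrite !gt_eqF// dlen_gt0.
rewrite (IH (right_half J))//; last by rewrite KJ /=; lia.
rewrite [X in _ + (X + _)]sum_haar_out//; last first.
  by move=> hr; exact: dset_halves_disjoint hr h.
rewrite (haar_right h) -mulrA mulrN sqrt_dlenK /mean dlen_right_half /delta.
by field; rewrite !gt_eqF// dlen_gt0.
Qed.

Lemma norm_mean_le phi I : intble setT phi ->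
  `|mean phi I| <= (\int[mu]_x `|phi x|) / dlen R I.
Proof.
move=> phii; rewrite /mean normrM normfV (gtr0_norm (dlen_gt0 I)).
rewrite ler_wpM2r ?invr_ge0 ?(ltW (dlen_gt0 I))//.
have li := intble_setT_locint phii.
apply: le_trans (dint_norm_le I li) _.
have ni : intble setT (fun x => `|phi x|) by exact: integrable_norm.
rewrite /dint -(Rintegral_indicM (dset R I)); apply: le_Rintegral => //.
  apply: intble_indicM; [exact: measurable_dset|exact: (locint_norm li).2].
move=> x _; rewrite indicE; case: (_ \in _); rewrite ?mul1r// mul0r//.
Qed.

Lemma mean_dyadic_at_cvg phi : intble setT phi ->
  {ae mu, forall x, (fun n => mean phi (dyadic_at (- n%:Z) x)) @ \oo --> phi x}.
Proof.
move=> phii.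
pose E (x : R) (n : nat) := dset R (dyadic_at (- n%:Z) x).
have dl x n : dlen R (dyadic_at (- n%:Z) x) = 2^-1 ^+ n.
  by rewrite /dlen /= -exprnN exprVn.
have shr x : nicely_shrinking x (E x).
  split; first by move=> n; exact: measurable_dset.
  have p0 n : 0 < (2^-1 : R) ^+ n by rewrite exprn_gt0.
  exists (2, fun n => PosNum (p0 n)); split => //=.
  - by apply: cvg_expr; rewrite ger0_norm// invf_lt1// ltr1n.
  - move=> n y /dsetE[h1 h2]; have /dsetE[h3 h4] := dset_dyadic_at (- n%:Z) x.
    rewrite -(dl x) /ball /=; apply/ltr_normlP; split; rewrite mulrDl mul1r in h2 h4; lra.
  - move=> n; rewrite lebesgue_measure_ball ?(ltW (p0 n))// /E lebesgue_dset dl.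
    by rewrite -EFinM mulr_natl.
have locf : locally_integrable setT phi.
  by apply: open_integrable_locally => //; exact: openT.
apply: ae_impl (lebesgue_differentiation locf) => x lx.
have := nice_lebesgue_differentiation shr locf lx.
move=> /fine_cvg; apply: cvg_trans; apply: near_eq_cvg; apply: nearW => n /=.
rewrite /E lebesgue_dset inver gt_eqF ?dlen_gt0//.
rewrite fineM//; first by rewrite mulrC.
have li := intble_setT_locint phii.
apply: integrable_fin_num; [exact: measurable_dset|exact: li.2].
Qed.

(** The partial sum is the mean over a small interval around x minus the mean
over an interval of length 2^N; the former converges by Lebesgue
differentiation and the latter tends to 0 since phi is integrable. *)
Lemma window_sum1_cvg phi : intble setT phi ->
  {ae mu, forall x, cvgn (fun N => window_sum (fun=> 1) phi N x)}.
Proof.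
move=> phii; have li := intble_setT_locint phii.
apply: ae_impl (mean_dyadic_at_cvg phii) => x cx.
(* the half of the window that contains x *)
pose J N : dyadic := if x < 0 then (N%:Z, -1) else (N%:Z, 0).
apply/cvg_ex; exists (phi x - 0).
have H : \forall N \near \oo, mean phi (dyadic_at (- N.+1%:Z) x) - mean phi (J N) =
    window_sum (fun=> 1) phi N x.
  have := near_window x; apply: filterS => N hN.
  have disj : dset R (N%:Z, -1) x -> dset R (N%:Z, 0) x -> False.
    by move=> h1 h2; have := @dset_scale_inj R (N%:Z, -1) (N%:Z, 0) _ erefl h1 h2.
  have JE : dset R (J N) x /\ window_sum (fun=> 1) phi N x =
      \sum_(I <- desc (2 * N + 1) (J N)) 1 * pairing phi (haar I) * haar I x.
    rewrite /window_sum /haar_comb /window big_cat /= /J.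
    move/dset_windowE : (hN) => [h|h].
      have x0 : x < 0.
        by move/dsetE : h; rewrite /= addNr mul0r => -[].
      rewrite x0; split => //; rewrite [X in _ + X]sum_haar_out ?addr0//.
      exact: disj.
    have x0 : x < 0 = false.
      by move/dsetE : h => /= []; rewrite mul0r => h0 _; rewrite ltNge h0.
    rewrite x0; split => //; rewrite [X in X + _]sum_haar_out ?add0r//.
    by move=> h'; exact: disj h' h.
  have [Jx ->] := JE.
  rewrite -(@haar_expansion_telescopes phi (2 * N + 1) _ _ x)//.
  - by apply: eq_bigr => I _; rewrite mul1r.
  - exact: dset_dyadic_at.
  - by rewrite /J; case: ifP => _ /=; lia.
apply: cvg_trans (near_eq_cvg H) _.
apply: cvgB; first by rewrite (cvg_shiftS (fun n => mean phi (dyadic_at (- n%:Z) x))).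
apply/cvgr0Pnorm_le => e e0.
pose M := \int[mu]_x `|phi x|.
have M0 : 0 <= M by apply: Rintegral_ge0.
have := near_window (M / e); apply: filterS => N /andP[_ hN].
have dlJ : dlen R (J N) = 2 ^+ N by rewrite /J /dlen; case: ifP.
apply: le_trans (norm_mean_le (J N) phii) _; rewrite dlJ -/M.
by rewrite ler_pdivrMr ?exprn_gt0// mulrC -ler_pdivrMr// ltW.
Qed.

End Averaging.

(** * Averaging over signs *)

Section SignAveraging.
Context {R : realType}.
Notation mu := (@lebesgue_measure R).
Implicit Types (I J K : dyadic) (f phi psi w v : R -> R) (l : seq dyadic)
  (s c : dyadic -> R).

Lemma near_sub_window l : \forall N \near \oo, {subset l <= window N}.
Proof.
elim: l => [|I l IH]; first by apply: nearW => N K; rewrite in_nil.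
near=> N => K; rewrite inE => /predU1P[->|].
  apply: (mem_window (dset_nonempty (R := R) I)).
    by near: N; exact: nbhs_infty_ge.
  by near: N; exact: near_window.
by move: K; near: N.
Unshelve. all: by end_near. Qed.

Lemma sum_window_restrict l N c : uniq l -> {subset l <= window N} ->
  \sum_(I <- window N | I \in l) c I = \sum_(I <- l) c I.
Proof.
move=> ul lN; rewrite -big_filter; apply: perm_big.
apply: uniq_perm => //; first by rewrite filter_uniq// (@window_uniq R).
by move=> I; rewrite mem_filter andb_idr//; exact: lN.
Qed.

(** Signs prescribed on l and constant elsewhere: for such signs the Haar
series converges where the one with constant signs does. *)
Definition fix_signs l s (e : R) I := if I \in l then s I else e.

Lemma fix_signs_unimodular l s : unimodular s ->
  unimodular (fix_signs l s 1) /\ unimodular (fix_signs l s (-1)).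
Proof.
by move=> us; split=> I; rewrite /fix_signs; case: ifP => _ //; [left|right].
Qed.

Lemma haar_multiplier_fix_signs l s e phi x : uniq l ->
  cvgn (fun N => window_sum (fun=> 1) phi N x) ->
  haar_multiplier (fix_signs l s e) phi x =
  e * limn (fun N => window_sum (fun=> 1) phi N x) +
  haar_comb l (fun I => (s I - e) * pairing phi (haar I)) x.
Proof.
move=> ul cv; rewrite haar_multiplierE; apply/cvg_lim => //.
have H : \forall N \near \oo,
    e * window_sum (fun=> 1) phi N x +
      haar_comb l (fun I => (s I - e) * pairing phi (haar I)) x =
    window_sum (fix_signs l s e) phi N x.
  apply: filterS (near_sub_window l) => N lN.
  rewrite /window_sum /haar_comb -(sum_window_restrict _ ul lN).
  rewrite [X in _ + X]big_mkcond mulr_sumr -big_split /=; apply: eq_bigr => I _.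
  by rewrite /fix_signs; case: ifP => _; ring.
apply: cvg_trans (near_eq_cvg H) _.
by apply: cvgD; [apply: cvgM => //; exact: cvg_cst|exact: cvg_cst].
Qed.

(** The contributions of the intervals outside l cancel. *)
Lemma haar_multiplier_fix_signs_mean l s phi x : uniq l ->
  cvgn (fun N => window_sum (fun=> 1) phi N x) ->
  haar_comb l (fun I => s I * pairing phi (haar I)) x =
  (haar_multiplier (fix_signs l s 1) phi x + haar_multiplier (fix_signs l s (-1)) phi x) / 2.
Proof.
move=> ul cv; rewrite !haar_multiplier_fix_signs// /haar_comb.
rewrite -[X in _ = X / 2](_ : \sum_(I <- l) 2 * (s I * pairing phi (haar I) * haar I x) = _).
  by rewrite -mulr_sumr mulrC mulKf.
rewrite mul1r mulN1r addrACA subrr add0r -big_split /=.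
by apply: eq_bigr => I _; ring.
Qed.

Lemma measurable_sqrM (T : R -> R) v : measurable_fun [set: R] T ->
  measurable_fun [set: R] v ->
  measurable_fun [set: measurableTypeR R] (fun x => (T x ^+ 2 * v x)%:E).
Proof.
move=> mT mv; apply/measurable_EFinP.
have h : measurable_fun [set: R] (fun x => T x ^+ 2 * v x).
  by apply: measurable_funM => //; exact: measurable_funX.
exact: h.
Qed.

(** A finite sum is the mean of two multipliers almost everywhere, and the
square is convex. *)
Lemma haar_comb_le_multiplier (D : set (measurableTypeR R)) phi v (M : R) l s :
  measurable D -> measurable_fun [set: R] v -> (forall x, 0 <= v x) ->
  intble setT phi ->
  (forall s, unimodular s ->
    (\int[mu]_(x in D) (haar_multiplier s phi x ^+ 2 * v x)%:E <= M%:E)%E) ->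
  uniq l -> unimodular s ->
  (\int[mu]_(x in D)
     (haar_comb l (fun I => s I * pairing phi (haar I)) x ^+ 2 * v x)%:E <= M%:E)%E.
Proof.
move=> mD mv v0 phii H ul us.
have [u1 u2] := fix_signs_unimodular l us.
set T1 := haar_multiplier (fix_signs l s 1) phi.
set T2 := haar_multiplier (fix_signs l s (-1)) phi.
have m1 : measurable_fun D (fun x => (T1 x ^+ 2 * v x)%:E).
  by apply: measurable_funTS; apply: measurable_sqrM => //; exact: measurable_haar_multiplier.
have m2 : measurable_fun D (fun x => (T2 x ^+ 2 * v x)%:E).
  by apply: measurable_funTS; apply: measurable_sqrM => //; exact: measurable_haar_multiplier.
have m0 : measurable_fun D (fun x => (haar_comb l
    (fun I => s I * pairing phi (haar I)) x ^+ 2 * v x)%:E).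
  by apply: measurable_funTS; apply: measurable_sqrM => //; have [] := bdd_haar_comb l
    (fun I => s I * pairing phi (haar I)).
have n1 (T : R -> R) x : D x -> (0 <= (T x ^+ 2 * v x)%:E)%E.
  by rewrite lee_fin mulr_ge0// sqr_ge0.
apply: (@le_trans _ _ (\int[mu]_(x in D)
    (2^-1%:E * ((T1 x ^+ 2 * v x)%:E + (T2 x ^+ 2 * v x)%:E)))%E).
  apply: ae_ge0_le_integral => //.
  - exact: n1.
  - by move=> x Dx; rewrite mule_ge0// adde_ge0// n1.
  - by apply: measurable_funeM; exact: emeasurable_funD.
  apply: ae_impl (window_sum1_cvg phii) => x cv Dx.
  rewrite (haar_multiplier_fix_signs_mean s ul cv) -/T1 -/T2 -EFinD -EFinM lee_fin.
  rewrite -mulrDl mulrA ler_wpM2r//.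
  by have := sqr_ge0 (T1 x - T2 x); nra.
rewrite ge0_integralZl_EFin//; last 2 first.
- by move=> x Dx; rewrite adde_ge0// n1.
- exact: emeasurable_funD.
rewrite ge0_integralD//; [|exact: n1|exact: n1].
apply: le_trans (_ : (2^-1%:E * (M%:E + M%:E) <= _)%E).
  by rewrite lee_wpmul2l// leeD// H.
by rewrite -EFinD -EFinM lee_fin; lra.
Qed.

Lemma intble_restrict J w : locint w -> intble setT (restrict_dyadic J w).
Proof. by move=> wi; apply: intble_indicM; [exact: measurable_dset|exact: wi.2]. Qed.

Lemma testing_conditionP w v C : testing_condition w v C <->
  forall J s, unimodular s ->
    (\int[mu]_(x in dset R J)
      (haar_multiplier s (restrict_dyadic J w) x ^+ 2 * v x)%:E <= (C * dint w J)%:E)%E.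
Proof.
have E J s : (\int[mu]_(x in dset R J)
    (`|haar_multiplier s (restrict_dyadic J w) x| ^+ 2 * v x)%:E =
  \int[mu]_(x in dset R J)
    (haar_multiplier s (restrict_dyadic J w) x ^+ 2 * v x)%:E)%E.
  by apply: eq_integral => x _; rewrite real_normK ?num_real.
have av J : C * average w J = (dlen R J)^-1 * (C * dint w J).
  by rewrite /average -/(dint w J); ring.
have l0 J : 0 < (dlen R J)^-1 by rewrite invr_gt0 dlen_gt0.
split=> [H J s us|H J].
  have h : (((dlen R J)^-1)%:E * \int[mu]_(x in dset R J)
      (haar_multiplier s (restrict_dyadic J w) x ^+ 2 * v x)%:E <=
      (C * average w J)%:E)%E.
    apply: le_trans (H J); apply: ereal_sup_ubound; exists s => //.
    by rewrite E.
  by move: h; rewrite av EFinM lee_pmul2l// lte_fin.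
apply: ge_ereal_sup => _ [s us <-]; rewrite av EFinM E lee_pmul2l ?lte_fin//.
exact: H.
Qed.

Lemma testing_fin_test w v C : locint w -> locint v -> (forall x, 0 < v x) ->
  testing_condition w v C -> fin_test w v C.
Proof.
move=> wi vi v0 /testing_conditionP test J l s ul us.
rewrite -lee_fin -dintE; last first.
  by apply: locintM => //; apply: bdd_measurableX2; exact: bdd_haar_comb.
apply: haar_comb_le_multiplier => //.
- exact: measurable_dset.
- exact: vi.1.
- by move=> x; exact: ltW.
- exact: intble_restrict.
- by move=> s' us'; exact: test.
Qed.

Lemma fin_test_testing w v C : locint w -> locint v -> (forall x, 0 < v x) ->
  fin_test w v C -> testing_condition w v C.
Proof.
move=> wi vi v0 test; apply/testing_conditionP => J s us.
apply: haar_multiplier_fatou => [|||N].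
- exact: measurable_dset.
- exact: vi.1.
- by move=> x; exact: ltW.
rewrite dintE; last first.
  by apply: locintM => //; apply: bdd_measurableX2; exact: bdd_haar_comb.
by rewrite lee_fin; apply: test => //; exact: (@window_uniq R).
Qed.

End SignAveraging.

(** * From testing to the norm inequality *)

Section SufficientBound.
Context {R : realType}.
Notation mu := (@lebesgue_measure R).
Implicit Types (I J K : dyadic) (f g phi psi w v F : R -> R) (l : seq dyadic)
  (s c : dyadic -> R).

Lemma locint_intble N phi : locint phi ->
  (forall x, phi x != 0 -> - 2 ^+ N <= x < 2 ^+ N) -> intble setT phi.
Proof.
move=> phii sup.
pose J1 : dyadic := (N%:Z, -1); pose J2 : dyadic := (N%:Z, 0).
have := intbleD measurableT (intble_indicM (measurable_dset J1) (phii.2 J1))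
  (intble_indicM (measurable_dset J2) (phii.2 J2)).
apply: eq_integrable => // x _ /=; congr EFin; rewrite !indicE.
have [z|/sup/dset_windowE h] := eqVneq (phi x) 0; first by rewrite z !mulr0 addr0.
have disj : dset R J1 x -> dset R J2 x -> False.
  by move=> h1 h2; have := @dset_scale_inj R J1 J2 _ erefl h1 h2.
case: h => h; rewrite (mem_set h) memNset ?mul1r ?mul0r ?addr0 ?add0r//.
  exact: disj.
by move=> h'; exact: disj h' h.
Qed.

Lemma haar_comb_window_out N c (x : R) : ~~ (- 2 ^+ N <= x < 2 ^+ N) ->
  haar_comb (window N) c x = 0.
Proof.
move=> hx; rewrite /haar_comb /window big_cat /= !sum_haar_out ?addr0// => h;
  by move/negP: hx; apply; apply/dset_windowE; (left + right).
Qed.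

Lemma dint_window_le N F : intble setT F -> (forall x, 0 <= F x) ->
  dint F (N%:Z, -1) + dint F (N%:Z, 0) <= \int[mu]_x F x.
Proof.
move=> Fi F0; have li := intble_setT_locint Fi.
pose J1 : dyadic := (N%:Z, -1); pose J2 : dyadic := (N%:Z, 0).
rewrite /dint -(Rintegral_indicM (dset R J1)) -(Rintegral_indicM (dset R J2)).
have i1 := intble_indicM (measurable_dset J1) (li.2 J1).
have i2 := intble_indicM (measurable_dset J2) (li.2 J2).
rewrite -RintegralD//; apply: le_Rintegral => //; first exact: intbleD.
move=> x _; rewrite !indicE.
have [h|h] := pselect (dset R J1 x); last first.
  rewrite (memNset h) mul0r add0r; case: (_ \in _); by rewrite ?mul1r// mul0r.
rewrite (mem_set h) memNset ?mul1r ?mul0r ?addr0// => h2.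
by have := @dset_scale_inj R J1 J2 _ erefl h h2.
Qed.

(** Take t = 1 / (2 K) and absorb the quadratic term. This turns a bilinear
estimate tested on a multiple t of the output into a norm bound. *)
Lemma quadratic_bound (E F K : R) : 0 < K ->
  (forall t, 0 < t -> t * E <= K * (F + t ^+ 2 * E)) -> E <= 4 * K ^+ 2 * F.
Proof.
move=> K0 /(_ (2 * K)^-1); rewrite invr_gt0 mulr_gt0// => /(_ isT) H.
have K20 : 0 < 4 * K by rewrite mulr_gt0.
move: H; rewrite -(ler_pM2l K20).
have -> : 4 * K * ((2 * K)^-1 * E) = 2 * E by field; rewrite gt_eqF.
have -> : 4 * K * (K * (F + (2 * K)^-1 ^+ 2 * E)) = 4 * K ^+ 2 * F + E.
  by field; rewrite gt_eqF.
by lra.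
Qed.

(** The bilinear estimate with psi = t v S and G = t ^ 2 v S ^ 2, where S is
the window sum, on the two halves of the window. *)
Lemma window_bound w v C phi F N s : locint w -> locint v ->
  (forall x, 0 < w x) -> (forall x, 0 < v x) -> 0 < C ->
  fin_test w v C -> fin_test v w C -> unimodular s ->
  locint phi -> intble setT F -> (forall x, 0 <= F x) ->
  (forall x, phi x ^+ 2 <= w x * F x) ->
  intble setT (fun x => window_sum s phi N x ^+ 2 * v x) /\
  \int[mu]_x (window_sum s phi N x ^+ 2 * v x) <=
  4 * test_const C ^+ 2 * \int[mu]_x F x.
Proof.
move=> wi vi w0 v0 C0 tw tv us phii Fi F0 pF.
set S := window_sum s phi N.
have bS : bdd_measurable S by exact: bdd_haar_comb.
have Si : locint (fun x => S x * v x) by exact: locintM.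
have S2i : locint (fun x => S x ^+ 2 * v x).
  by apply: locintM => //; exact: bdd_measurableX2.
have S2I : intble setT (fun x => S x ^+ 2 * v x).
  apply: (@locint_intble N) => // x; apply: contraNT => hx.
  by rewrite /S /window_sum haar_comb_window_out// expr0n mul0r.
split=> //.
have K0 : 0 < test_const C by rewrite /test_const /bilinear_const; lra.
apply: quadratic_bound => // t t0.
have EE : \int[mu]_x (S x ^+ 2 * v x) =
    \sum_(I <- window N) s I * pairing phi (haar I) * pairing (fun x => S x * v x) (haar I).
  rewrite -Rintegral_haar_comb//; apply: eq_Rintegral => x _.
  by rewrite expr2 -mulrA.
have psii := locintZ t Si.
have Gi : locint (fun x => t ^+ 2 * (S x ^+ 2 * v x)) by exact: locintZ.
have pG x : (t * (S x * v x)) ^+ 2 <= v x * (t ^+ 2 * (S x ^+ 2 * v x)).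
  by rewrite le_eqVlt; apply/orP; left; apply/eqP; ring.
have li := intble_setT_locint Fi.
have B J := fin_test_bilinear (2 * N + 1) J wi vi w0 v0 C0 tw tv phii psii li Gi pF pG.
rewrite [X in t * X <= _]EE.
apply: (@le_trans _ _ (\sum_(I <- window N)
    `|pairing phi (haar I) * pairing (fun x => t * (S x * v x)) (haar I)|)).
  rewrite mulr_sumr; apply: ler_sum => I _; rewrite pairingZ//.
  rewrite [leLHS](_ : _ = s I * (pairing phi (haar I) *
    (t * pairing (fun x => S x * v x) (haar I)))); last by ring.
  by apply: le_trans (ler_norm _) _; case: (us I) => ->; rewrite ?mul1r// mulN1r normrN.
rewrite /window big_cat /=; apply: le_trans (lerD (B _) (B _)) _.
rewrite !dintZ// -mulrDr ler_pM2l//.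
have h1 := @dint_window_le N _ Fi F0.
have h2 : dint (fun x => S x ^+ 2 * v x) (N%:Z, -1) +
    dint (fun x => S x ^+ 2 * v x) (N%:Z, 0) <= \int[mu]_x (S x ^+ 2 * v x).
  by apply: dint_window_le => // x; rewrite mulr_ge0 ?sqr_ge0// ltW.
by have := ler_wpM2l (sqr_ge0 t) h2; lra.
Qed.

Lemma compact_support_window f : bounded_compactly_supported f ->
  exists N, forall x, f x != 0 -> - 2 ^+ N <= x < 2 ^+ N.
Proof.
move=> [_ _ /compact_bounded[M [_ HM]]].
have [N _ HN] := near_window (M + 1); exists N => x fx.
have xM : `|x| <= M + 1.
  by apply: (HM (M + 1)); [rewrite ltrDl|apply: subset_closure].
have /andP[_ h] := HN N (leqnn N).
have : `|x| < 2 ^+ N by exact: le_lt_trans h.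
by rewrite ltr_norml => /andP[/ltW -> ->].
Qed.

Lemma bounded_compactly_supported_bdd f : bounded_compactly_supported f -> bdd_measurable f.
Proof. by case. Qed.

Lemma locint_sqrt w : locint w -> (forall x, 0 < w x) ->
  locint (fun x => Num.sqrt (w x)).
Proof.
move=> wi w0; have mq : measurable_fun [set: R] (fun x => Num.sqrt (w x)).
  apply: measurableT_comp; last exact: wi.1.
  by apply: continuous_measurable_fun; exact: sqrt_continuous.
split => // I.
apply: (@intble_le R _ _ (fun x => 1 + w x)) => //; first exact: measurable_dset.
  move=> x _; rewrite ger0_norm//.
  have := sqr_sqrtr (ltW (w0 x)); have := sqr_ge0 (Num.sqrt (w x) - 1).
  have := sqrtr_ge0 (w x); nra.
apply: intbleD; [exact: measurable_dset| |exact: wi.2].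
by apply: (locint_bdd _).2; exact: bdd_cst.
Qed.

Lemma locint_mul_sqrt w f : locint w -> (forall x, 0 < w x) ->
  bdd_measurable f -> locint (mul_sqrt w f).
Proof.
move=> wi w0 bf; have := locintM bf (locint_sqrt wi w0).
by congr locint; apply/funext => x; rewrite mulrC.
Qed.

Lemma intble_mul_sqrt w f : locint w -> (forall x, 0 < w x) ->
  bounded_compactly_supported f -> intble setT (mul_sqrt w f).
Proof.
move=> wi w0 bf; have [N HN] := compact_support_window bf.
apply: (@locint_intble N); first exact/locint_mul_sqrt/bounded_compactly_supported_bdd.
move=> x h; apply: HN; apply: contraNneq h => fx.
by rewrite /mul_sqrt fx mulr0.
Qed.

Lemma intble_sqr f : bounded_compactly_supported f ->
  intble setT (fun x => f x ^+ 2).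
Proof.
move=> bf; have [N HN] := compact_support_window bf.
apply: (@locint_intble N); first exact/locint_bdd/bdd_measurableX2/bounded_compactly_supported_bdd.
by move=> x h; apply: HN; apply: contraNneq h => ->; rewrite expr0n.
Qed.

(** The L^2 bound in squared form, for an everywhere positive v: the factor
v^(1/2) has been moved into the measure. *)
Definition weighted_bound v w (M : R) := forall s, unimodular s ->
  forall f, bounded_compactly_supported f ->
  (\int[mu]_x (haar_multiplier s (mul_sqrt w f) x ^+ 2 * v x)%:E <=
   M%:E * \int[mu]_x (f x ^+ 2)%:E)%E.

Lemma fin_test_weighted_bound w v C : locint w -> locint v ->
  (forall x, 0 < w x) -> (forall x, 0 < v x) -> 0 < C ->
  fin_test w v C -> fin_test v w C ->
  weighted_bound v w (4 * test_const C ^+ 2).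
Proof.
move=> wi vi w0 v0 C0 tw tv s us f bf.
have f2i := intble_sqr bf.
have phii := locint_mul_sqrt wi w0 (bounded_compactly_supported_bdd bf).
have pF x : mul_sqrt w f x ^+ 2 <= w x * f x ^+ 2.
  by rewrite /mul_sqrt exprMn sqr_sqrtr// ltW.
rewrite (RintegralE f2i) -EFinM; apply: haar_multiplier_fatou => //.
- exact: vi.1.
- by move=> x; exact: ltW.
move=> N.
have [i B] := window_bound N wi vi w0 v0 C0 tw tv us phii f2i (fun x => sqr_ge0 _) pF.
by rewrite RintegralE// lee_fin.
Qed.

End SufficientBound.

(** * From the norm inequality to testing *)

Section Necessity.
Context {R : realType}.
Notation mu := (@lebesgue_measure R).
Implicit Types (I J : dyadic) (f g k phi psi w v F : R -> R) (l : seq dyadic)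
  (s c : dyadic -> R).

(** Signs making every term nonnegative turn the sum into the integral of S
v^(1/2) g, with S a Haar sum controlled by the norm bound. *)
Lemma weighted_bound_bilinear v w (M : R) f g l : locint w -> locint v ->
  (forall x, 0 < w x) -> (forall x, 0 < v x) -> 0 <= M ->
  weighted_bound v w M ->
  bounded_compactly_supported f -> bounded_compactly_supported g -> uniq l ->
  \sum_(I <- l) `|pairing (mul_sqrt w f) (haar I) * pairing (mul_sqrt v g) (haar I)| <=
  (M + 1) * (\int[mu]_x f x ^+ 2 + \int[mu]_x g x ^+ 2).
Proof.
move=> wi vi w0 v0 M0 bound bf bg ul.
set phi := mul_sqrt w f; set psi := mul_sqrt v g.
have f2i := intble_sqr bf; have g2i := intble_sqr bg.
have phii : intble setT phi by exact: intble_mul_sqrt.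
have psii : locint psi by exact/locint_mul_sqrt/bounded_compactly_supported_bdd.
pose e I : R := if 0 <= pairing phi (haar I) * pairing psi (haar I) then 1 else -1.
have ue : unimodular e by move=> I; rewrite /e; case: ifP; [left|right].
pose S := haar_comb l (fun I => e I * pairing phi (haar I)).
have bS : bdd_measurable S by exact: bdd_haar_comb.
have S2i : intble setT (fun x => S x ^+ 2 * v x).
  have := intble_haar_comb l (fun I => e I * pairing phi (haar I)) (locintM bS vi).
  by apply: eq_integrable => // x _ /=; rewrite mulrA.
have SB : \int[mu]_x (S x ^+ 2 * v x) <= M * \int[mu]_x f x ^+ 2.
  rewrite -lee_fin -(RintegralE S2i).
  apply: haar_comb_le_multiplier => //.
  - exact: vi.1.
  - by move=> x; exact: ltW.
  - by move=> s us; rewrite EFinM -(RintegralE f2i); exact: bound.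
have -> : \sum_(I <- l) `|pairing phi (haar I) * pairing psi (haar I)| =
    \int[mu]_x (S x * psi x).
  rewrite Rintegral_haar_comb//; apply: eq_bigr => I _.
  rewrite -mulrA /e; case: ifPn => h; first by rewrite mul1r ger0_norm.
  by rewrite mulN1r ler0_norm// ltW// ltNge.
apply: (@le_trans _ _ (\int[mu]_x (S x ^+ 2 * v x + g x ^+ 2))); last first.
  rewrite RintegralD//.
  have h1 : 0 <= \int[mu]_x f x ^+ 2 by apply: Rintegral_ge0 => x _; exact: sqr_ge0.
  have h2 : 0 <= \int[mu]_x g x ^+ 2 by apply: Rintegral_ge0 => x _; exact: sqr_ge0.
  rewrite mulrDl mul1r mulrDr; apply: lerD; last by rewrite lerDr.
  by apply: le_trans SB _; rewrite lerDl mulr_ge0.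
apply: le_Rintegral => //.
- exact: intble_haar_comb.
- exact: intbleD.
move=> x _; rewrite /psi /mul_sqrt.
have := sqr_sqrtr (ltW (v0 x)); set q := Num.sqrt (v x) => <-.
have := sqr_ge0 (S x * q - g x); have := sqr_ge0 (S x * q); have := sqr_ge0 (g x).
by rewrite !exprMn; nra.
Qed.

(** Bounded approximations of w^(1/2) k: the norm bound is only available for
bounded inputs, whereas testing uses w^(1/2) on an interval. *)
Definition truncation w k (m : nat) (x : R) : R :=
  if w x <= m%:R then Num.sqrt (w x) * k x else 0.

Lemma truncation_bcs w k m J : locint w -> (forall x, 0 < w x) ->
  bdd_measurable k -> (forall x, ~ dset R J x -> k x = 0) ->
  bounded_compactly_supported (truncation w k m).
Proof.
move=> wi w0 [mk [M kM]] kJ; split.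
- apply: measurable_fun_ifT.
  + by apply: measurable_fun_ler => //; exact: wi.1.
  + by apply: measurable_funM => //; exact: (locint_sqrt wi w0).1.
  + exact: measurable_cst.
- exists (Num.sqrt m%:R * M) => x; rewrite /truncation.
  have M0 : 0 <= M by exact: le_trans (kM x).
  case: ifP => wm; last by rewrite normr0 mulr_ge0.
  by rewrite normrM (ger0_norm (sqrtr_ge0 _)) ler_pM// ler_sqrt.
- set a : R := J.2%:~R * dlen R J; set b : R := (J.2 + 1)%:~R * dlen R J.
  apply: (@subclosed_compact _ _ `[a, b]%classic).
  + exact: closed_closure.
  + exact: segment_compact.
  + have /closure_id -> : closed `[a, b]%classic by exact: itv_closed.
    apply: closureS => x /= h; have : dset R J x.
      apply: contrapT => /kJ kx; move: h; rewrite /truncation kx mulr0.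
      by case: ifP; rewrite eqxx.
    by rewrite /dset /= !in_itv /= => /andP[-> /ltW ->].
Qed.

Lemma int_truncation_le w k m J : locint w -> (forall x, 0 < w x) ->
  bdd_measurable k -> (forall x, ~ dset R J x -> k x = 0) ->
  \int[mu]_x truncation w k m x ^+ 2 <= dint (fun x => k x ^+ 2 * w x) J.
Proof.
move=> wi w0 bk kJ.
have ki : locint (fun x => k x ^+ 2 * w x).
  by apply: locintM => //; exact: bdd_measurableX2.
rewrite /dint -(Rintegral_indicM (dset R J)); apply: le_Rintegral => //.
- exact: intble_sqr (truncation_bcs m wi w0 bk kJ).
- by apply: intble_indicM; [exact: measurable_dset|exact: ki.2].
move=> x _; rewrite /truncation indicE.
have [h|h] := pselect (dset R J x); last first.
  by rewrite kJ// mulr0 memNset// mul0r; case: ifP => _; rewrite expr0n.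
rewrite mem_set// mul1r; case: ifP => _.
  by rewrite exprMn sqr_sqrtr ?(ltW (w0 x))// mulrC.
by rewrite expr0n /= mulr_ge0 ?sqr_ge0// ltW.
Qed.

Lemma pairing_truncation_cvg w k I J : locint w -> (forall x, 0 < w x) ->
  bdd_measurable k -> (forall x, ~ dset R J x -> k x = 0) ->
  (fun m => pairing (mul_sqrt w (truncation w k m)) (haar I)) @ \oo -->
  pairing (fun x => k x * w x) (haar I).
Proof.
move=> wi w0 bk kJ.
have kwi : locint (fun x => k x * w x) by exact: locintM.
have TE m x : mul_sqrt w (truncation w k m) x = if w x <= m%:R then k x * w x else 0.
  rewrite /mul_sqrt /truncation; case: ifP => _; last by rewrite mulr0.
  by rewrite mulrA -expr2 sqr_sqrtr ?(ltW (w0 x))// mulrC.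
have hi : intble setT (fun x => k x * w x * haar I x).
  by apply: eq_integrable (intble_haar I kwi) => // x _ /=; rewrite mulrC.
have mT m : measurable_fun [set: R] (fun x => mul_sqrt w (truncation w k m) x * haar I x).
  apply: measurable_funM; last by have [] := @bdd_haar R I.
  exact: (locint_mul_sqrt wi w0 (bounded_compactly_supported_bdd (truncation_bcs m wi w0 bk kJ))).1.
have [] := @dominated_convergence _ _ _ mu setT measurableT
  (fun m x => (mul_sqrt w (truncation w k m) x * haar I x)%:E)
  (fun x => (k x * w x * haar I x)%:E) (fun x => (`|k x * w x * haar I x|)%:E).
- by move=> m; apply/measurable_EFinP; exact: mT.
- exact: measurable_int hi.
- apply: aeW => x _; apply: cvg_near_cst.
  exists (Num.truncn (w x)).+1 => // m /= hm; rewrite TE ifT//.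
  by rewrite (le_trans (ltW (truncnS_gt _)))// ler_nat.
- exact: integrable_norm hi.
- apply: aeW => x m _; rewrite TE /= lee_fin.
  by case: ifP => _; rewrite ?mul0r ?normr0.
move=> _ _; rewrite (RintegralE hi) => h; exact: (fine_cvg h).
Qed.

Lemma cvg_sum_seq (l : seq dyadic) (u : dyadic -> nat -> R) (a : dyadic -> R) :
  (forall I, u I @ \oo --> a I) ->
  (fun m => \sum_(I <- l) u I m) @ \oo --> \sum_(I <- l) a I.
Proof.
move=> ua; elim: l => [|I l IH].
  rewrite big_nil (_ : (fun m => _) = cst 0); first exact: cvg_cst.
  by apply/funext => m; rewrite big_nil.
rewrite big_cons (_ : (fun m => _) = (fun m => u I m + \sum_(K <- l) u K m)).
  exact: cvgD.
by apply/funext => m; rewrite big_cons.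
Qed.

(** A consequence of the norm bound that is symmetric in the two weights,
hence yields both testing conditions. *)
Definition bilinear_bound w v (K : R) := forall k g l J,
  bdd_measurable k -> bdd_measurable g ->
  (forall x, ~ dset R J x -> k x = 0) -> (forall x, ~ dset R J x -> g x = 0) ->
  uniq l ->
  \sum_(I <- l) `|pairing (fun x => k x * w x) (haar I) *
                  pairing (fun x => g x * v x) (haar I)| <=
  K * (dint (fun x => k x ^+ 2 * w x) J + dint (fun x => g x ^+ 2 * v x) J).

Lemma bilinear_bound_sym w v (K : R) : bilinear_bound w v K -> bilinear_bound v w K.
Proof.
move=> B k g l J bk bg kJ gJ ul; rewrite addrC.
under eq_bigr do rewrite mulrC.
exact: B.
Qed.

Lemma weighted_bound_bilinear_bound v w (M : R) : locint w -> locint v ->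
  (forall x, 0 < w x) -> (forall x, 0 < v x) -> 0 <= M ->
  weighted_bound v w M -> bilinear_bound w v (M + 1).
Proof.
move=> wi vi w0 v0 M0 bound k k' l J bk bk' kJ kJ' ul.
have cv : (fun m => \sum_(I <- l) `|pairing (mul_sqrt w (truncation w k m)) (haar I) *
      pairing (mul_sqrt v (truncation v k' m)) (haar I)|) @ \oo -->
    \sum_(I <- l) `|pairing (fun x => k x * w x) (haar I) *
                  pairing (fun x => k' x * v x) (haar I)|.
  apply: cvg_sum_seq => I.
  have c1 := @pairing_truncation_cvg w k I J wi w0 bk kJ.
  have c2 := @pairing_truncation_cvg v k' I J vi v0 bk' kJ'.
  exact: cvg_norm (cvgM c1 c2).
apply: (@closed_cvg _ _ _ _ _ (fun y : R => y <= (M + 1) *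
  (dint (fun x => k x ^+ 2 * w x) J + dint (fun x => k' x ^+ 2 * v x) J)) _ _ _ cv).
  exact: closed_le.
apply: nearW => m.
apply: le_trans (weighted_bound_bilinear wi vi w0 v0 M0 bound
  (truncation_bcs m wi w0 bk kJ) (truncation_bcs m vi v0 bk' kJ') ul) _.
apply: ler_wpM2l; first exact: addr_ge0.
by apply: lerD; exact: int_truncation_le.
Qed.

(** Take k = chi_J and g = t chi_J S, where S is the Haar sum to be estimated.
*)
Lemma bilinear_bound_fin_test w v (K : R) : locint w -> locint v -> 0 < K ->
  bilinear_bound w v K -> fin_test w v (4 * K ^+ 2).
Proof.
move=> wi vi K0 B J l s ul us.
set S := haar_comb l _; apply: quadratic_bound => // t t0.
have bS : bdd_measurable S by exact: bdd_haar_comb.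
have bJ : bdd_measurable (\1_(dset R J) : R -> R).
  by apply: bdd_indic; exact: measurable_dset.
have outJ x : ~ dset R J x -> \1_(dset R J) x = 0 :> R.
  by move=> h; rewrite indicE memNset.
pose g x := \1_(dset R J) x * S x.
have bg : bdd_measurable g by exact: bdd_measurableM.
have gvi : locint (fun x => g x * v x) by exact: locintM.
have S2i : locint (fun x => S x ^+ 2 * v x).
  by apply: locintM => //; exact: bdd_measurableX2.
have := B \1_(dset R J) (fun x => t * g x) l J bJ (bdd_measurableZ t bg) outJ _ ul.
move=> /(_ _); rewrite (_ : dint (fun x => \1_(dset R J) x ^+ 2 * w x) J = dint w J); last first.
  by apply: eq_dint => x Jx; rewrite indicE mem_set// expr1n mul1r.
rewrite (_ : dint (fun x => (t * g x) ^+ 2 * v x) J =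
    t ^+ 2 * dint (fun x => S x ^+ 2 * v x) J); last first.
  rewrite -dintZ//; apply: eq_dint => x Jx.
  by rewrite /g indicE mem_set// mul1r exprMn mulrA.
move=> h; apply: le_trans (h _); last by move=> x Jx; rewrite /g outJ// mul0r mulr0.
rewrite (_ : dint (fun x => S x ^+ 2 * v x) J = \int[mu]_x (S x * (g x * v x))); last first.
  rewrite /dint -(Rintegral_indicM (dset R J)); apply: eq_Rintegral => x _.
  by rewrite /g; ring.
rewrite Rintegral_haar_comb// mulr_sumr; apply: ler_sum => I _.
have -> : pairing (fun x => t * g x * v x) (haar I) =
    t * pairing (fun x => g x * v x) (haar I).
  by rewrite -pairingZ//; apply: eq_Rintegral => x _; ring.
set c := pairing _ _; set d := pairing (fun x => g x * v x) _.
have -> : t * (s I * c * d) = s I * (c * (t * d)) by ring.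
by apply: le_trans (ler_norm _) _; case: (us I) => ->; rewrite ?mul1r// mulN1r normrN.
Qed.

End Necessity.

(** * Operator norms and modification of the weights on null sets *)

Section NullSets.
Context {R : realType}.
Notation mu := (@lebesgue_measure R).
Implicit Types (I J : dyadic) (f g k phi psi w v F : R -> R) (l : seq dyadic)
  (s c : dyadic -> R).

Lemma fin_test_mono w v (C C' : R) : (forall J, 0 <= dint w J) -> C <= C' ->
  fin_test w v C -> fin_test w v C'.
Proof.
move=> W0 CC' test J l s ul us; apply: le_trans (test J l s ul us) _.
by rewrite ler_wpM2r.
Qed.

Lemma weighted_bound_iff_testing w v : locint w -> locint v ->
  (forall x, 0 < w x) -> (forall x, 0 < v x) ->
  (exists2 M, 0 <= M & weighted_bound v w M) <->
  exists C, testing_condition w v C /\ testing_condition v w C.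
Proof.
move=> wi vi w0 v0; split=> [[M M0 bound]|[C [t1 t2]]].
  have M1 : 0 < M + 1 by rewrite ltr_wpDl.
  have B := weighted_bound_bilinear_bound wi vi w0 v0 M0 bound.
  exists (4 * (M + 1) ^+ 2); split; apply: fin_test_testing => //.
    exact: bilinear_bound_fin_test.
  by apply: bilinear_bound_fin_test => //; exact: bilinear_bound_sym.
have C1 : C <= `|C| + 1 by rewrite (le_trans (ler_norm C))// lerDl.
have C0 : 0 < `|C| + 1 by rewrite ltr_wpDl.
exists (4 * test_const (`|C| + 1) ^+ 2); first by rewrite mulr_ge0 ?sqr_ge0.
apply: fin_test_weighted_bound => //; apply: fin_test_mono C1 _.
- by move=> J; apply/ltW/dint_gt0.
- exact: testing_fin_test.
- by move=> J; apply/ltW/dint_gt0.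
- exact: testing_fin_test.
Qed.

Lemma sqr_Lnorm2 g :
  (poweR (Lnorm mu 2%:E (EFin \o g)) 2 = \int[mu]_x (g x ^+ 2)%:E)%E.
Proof.
rewrite poweR_Lnorm//; apply: eq_integral => x _ /=.
by rewrite (powR_mulrn 2)// real_normK ?num_real.
Qed.

Lemma Lnorm2E g :
  (Lnorm mu 2%:E (EFin \o g) = poweR (\int[mu]_x (g x ^+ 2)%:E) 2^-1)%E.
Proof.
by rewrite -sqr_Lnorm2 -poweRrM mulfV// poweRe1// Lnorm_ge0.
Qed.

Lemma Lnorm2_le f g (C : R) : 0 <= C ->
  (Lnorm mu 2%:E (EFin \o g) <= C%:E * Lnorm mu 2%:E (EFin \o f))%E <->
  (\int[mu]_x (g x ^+ 2)%:E <= (C ^+ 2)%:E * \int[mu]_x (f x ^+ 2)%:E)%E.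
Proof.
move=> C0.
have CE : (C%:E = poweR (C ^+ 2)%:E 2^-1)%E.
  by rewrite poweR_EFin powR12_sqrt ?sqr_ge0// sqrtr_sqr ger0_norm.
have C2 : ((C ^+ 2)%:E = poweR C%:E 2)%E by rewrite poweR_EFin (powR_mulrn 2).
have pos (h : R -> R) : (0 <= \int[mu]_x (h x ^+ 2)%:E)%E.
  by apply: integral_ge0 => x _; rewrite lee_fin sqr_ge0.
have inI (y : \bar R) : (0 <= y)%E -> y \in `[0%E, +oo%E].
  by move=> y0; rewrite in_itv /= y0 leey.
split=> h.
  rewrite -!sqr_Lnorm2 C2 -poweRM// ?Lnorm_ge0 ?lee_fin//.
  apply: gt0_ler_poweR => //; apply: inI; first exact: Lnorm_ge0.
  by rewrite mule_ge0 ?lee_fin// Lnorm_ge0.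
rewrite !Lnorm2E CE -poweRM ?lee_fin ?sqr_ge0//.
apply: gt0_ler_poweR => //.
  exact/inI/pos.
by apply: inI; rewrite mule_ge0 ?lee_fin ?sqr_ge0.
Qed.

Definition positive_version w (x : R) : R := if 0 < w x then w x else 1.

Lemma positive_version_gt0 w x : 0 < positive_version w x.
Proof. by rewrite /positive_version; case: ifP. Qed.

Lemma weight_ae w : weight w -> {ae mu, forall x, 0 < w x /\ w x = positive_version w x}.
Proof.
move=> [_ h]; apply: ae_impl h => x wx; split => //.
by rewrite /positive_version wx.
Qed.

Lemma weight_ae_eq w : weight w -> {ae mu, forall x, w x = positive_version w x}.
Proof. by move/weight_ae; apply: ae_impl => x []. Qed.

Lemma weight_ae_eq_sym w : weight w ->
  {ae mu, forall x, positive_version w x = w x}.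
Proof. by move/weight_ae; apply: ae_impl => x []. Qed.

Lemma weight_locint w : weight w -> locint w.
Proof.
move=> [[mw _ wK] _]; split => // I.
set a : R := I.2%:~R * dlen R I; set b : R := (I.2 + 1)%:~R * dlen R I.
apply: (@integrableS _ _ _ mu `[a, b]%classic).
- exact: measurable_itv.
- exact: measurable_dset.
- by move=> x; rewrite /dset /= !in_itv /= => /andP[-> /ltW ->].
apply/integrableP; split; last by apply: wK => //; exact: segment_compact.
by apply/measurable_EFinP; exact: measurable_funS mw.
Qed.

Lemma positive_version_locint w : weight w -> locint (positive_version w).
Proof.
move=> ww; have wi := weight_locint ww.
have m1 : measurable_fun [set: R] (positive_version w).
  apply: measurable_fun_ifT; last exact: measurable_cst; last exact: wi.1.
  by apply: measurable_fun_ltr => //; exact: wi.1.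
split => // I; have mI := @measurable_dset R I.
apply: (@intble_le R _ _ (fun x => 1 + `|w x|)) => //.
  move=> x _; rewrite gtr0_norm ?positive_version_gt0// /positive_version.
  case: ifP => [w0|_]; last by rewrite lerDl.
  by rewrite gtr0_norm// lerDr.
apply: intbleD => //; last exact: (locint_norm wi).2.
by apply: (locint_bdd _).2; exact: bdd_cst.
Qed.

Lemma ae_eq_pairing phi psi I : measurable_fun [set: R] phi ->
  measurable_fun [set: R] psi -> {ae mu, forall x, phi x = psi x} ->
  pairing phi (haar I) = pairing psi (haar I).
Proof.
move=> m1 m2 e; have [mh _] := @bdd_haar R I.
have mm (f : R -> R) : measurable_fun [set: R] f ->
    measurable_fun [set: measurableTypeR R] (fun x => (f x * haar I x)%:E).
  move=> mf; apply/measurable_EFinP.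
  have h : measurable_fun [set: R] (fun x => f x * haar I x) by exact: measurable_funM.
  exact: h.
congr fine; apply: ae_eq_integral => //; [exact: mm|exact: mm|].
by apply: ae_impl e => x -> _.
Qed.

Lemma ae_eq_dint f g J : measurable_fun [set: R] f -> measurable_fun [set: R] g ->
  {ae mu, forall x, f x = g x} -> dint f J = dint g J.
Proof.
move=> m1 m2 e; have mJ := @measurable_dset R J.
congr fine; apply: ae_eq_integral => //.
- by apply/measurable_EFinP; exact: measurable_funS m1.
- by apply/measurable_EFinP; exact: measurable_funS m2.
by apply: ae_impl e => x -> _.
Qed.

Lemma ae_eq_testing w w' v v' (C : R) :
  measurable_fun [set: R] w -> measurable_fun [set: R] w' ->
  measurable_fun [set: R] v -> measurable_fun [set: R] v' ->
  {ae mu, forall x, w x = w' x} -> {ae mu, forall x, v x = v' x} ->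
  testing_condition w v C -> testing_condition w' v' C.
Proof.
move=> mw mw' mv mv' ew ev /testing_conditionP H; apply/testing_conditionP => J s us.
rewrite -(ae_eq_dint J mw mw' ew).
have mr u : measurable_fun [set: R] u -> measurable_fun [set: R] (restrict_dyadic J u).
  by move=> mu_; apply: measurable_funM => //; have [] := bdd_indic (@measurable_dset R J).
rewrite -(@eq_haar_multiplier _ s (restrict_dyadic J w)); last first.
  move=> I; apply: ae_eq_pairing; [exact: mr|exact: mr|].
  by apply: ae_impl ew => x; rewrite /restrict_dyadic => ->.
apply: le_trans (H J s us); rewrite le_eqVlt; apply/orP; left; apply/eqP.
have mT := measurable_haar_multiplier s (restrict_dyadic J w).
apply: ae_eq_integral.
- exact: measurable_dset.
- by apply: measurable_funTS; exact: measurable_sqrM.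
- by apply: measurable_funTS; exact: measurable_sqrM.
by apply: ae_impl ev => x -> _.
Qed.

Lemma measurable_mul_sqrt w f : measurable_fun [set: R] w ->
  measurable_fun [set: R] f -> measurable_fun [set: R] (mul_sqrt w f).
Proof.
move=> mw mf; apply: measurable_funM => //; apply: measurableT_comp => //.
by apply: continuous_measurable_fun; exact: sqrt_continuous.
Qed.

Lemma int_sqr_two_weight v w s f : weight v -> weight w ->
  measurable_fun [set: R] f ->
  (\int[mu]_x (two_weight_multiplier v w s f x ^+ 2)%:E =
   \int[mu]_x (haar_multiplier s (mul_sqrt (positive_version w) f) x ^+ 2 *
     positive_version v x)%:E)%E.
Proof.
move=> wv ww mf.
have [mv _] := weight_locint wv; have [mw _] := weight_locint ww.
have [mv' _] := positive_version_locint wv; have [mw' _] := positive_version_locint ww.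
have TE : haar_multiplier s (mul_sqrt w f) =
    haar_multiplier s (mul_sqrt (positive_version w) f).
  apply: eq_haar_multiplier => I; apply: ae_eq_pairing.
  - exact: measurable_mul_sqrt.
  - exact: measurable_mul_sqrt.
  by apply: ae_impl (weight_ae ww) => x [_ wx]; rewrite /mul_sqrt -wx.
have mT := measurable_haar_multiplier s (mul_sqrt w f).
rewrite /two_weight_multiplier -TE; apply: ae_eq_integral => //.
- have h : measurable_fun [set: R]
      (fun x => mul_sqrt v (haar_multiplier s (mul_sqrt w f)) x ^+ 2).
    by apply: measurable_funX; exact: measurable_mul_sqrt.
  by apply/measurable_EFinP; exact: h.
- exact: measurable_sqrM.
apply: ae_impl (weight_ae wv) => x [vx <-] _ /=.
by rewrite /mul_sqrt exprMn sqr_sqrtr ?(ltW vx)// mulrC.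
Qed.

Lemma opnorm_bounded_iff v w : weight v -> weight w ->
  (ereal_sup [set L2_opnorm (two_weight_multiplier v w s) | s in signs R] < +oo)%E
  <-> exists2 M, 0 <= M & weighted_bound (positive_version v) (positive_version w) M.
Proof.
move=> wv ww; split=> [supy|[M M0 bound]].
  have [K K0 HK] : exists2 K : R, 0 <= K &
      forall s, unimodular s -> (L2_opnorm (two_weight_multiplier v w s) < K%:E)%E.
    set S := ereal_sup _ in supy.
    exists (`|fine S| + 1); first by rewrite addr_ge0.
    move=> s us; have : (L2_opnorm (two_weight_multiplier v w s) <= S)%E.
      by apply: ereal_sup_ubound; exists s.
    move/le_lt_trans; apply; case: (S) supy => [r _||] //=; last by rewrite ltNyr.
    by rewrite lte_fin (le_lt_trans (ler_norm r))// ltrDl.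
  exists (K ^+ 2); first exact: sqr_ge0.
  move=> s us f bf.
  have mf : measurable_fun [set: R] f by case: bf.
  have /ereal_inf_lt [_ [C [C0 HC] <-]] := HK s us.
  rewrite lte_fin => CK.
  have := (Lnorm2_le f (two_weight_multiplier v w s f) C0).1 (HC f bf).
  rewrite int_sqr_two_weight// => /le_trans; apply.
  apply: lee_wpmul2r; first by apply: integral_ge0 => x _; rewrite lee_fin sqr_ge0.
  by rewrite lee_fin ler_sqr ?nnegrE ?(ltW CK).
apply: (@le_lt_trans _ _ (Num.sqrt M)%:E); last exact: ltry.
apply: ge_ereal_sup => _ [s us <-]; apply: ereal_inf_lbound.
exists (Num.sqrt M) => //; split=> // f bf.
have mf : measurable_fun [set: R] f by case: bf.
apply/Lnorm2_le => //; rewrite sqr_sqrtr// int_sqr_two_weight//.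
exact: bound.
Qed.

End NullSets.

Theorem theorem0p1 (R : realType) (v w : R -> R)
    (hv : weight v) (hw : weight w) :
  (ereal_sup [set L2_opnorm (two_weight_multiplier v w s) | s in signs R] < +oo)%E
  <->
  exists C : R, testing_condition w v C /\ testing_condition v w C.
Proof.
have vi := positive_version_locint hv; have wi := positive_version_locint hw.
have [mv _] := weight_locint hv; have [mw _] := weight_locint hw.
have ev := weight_ae_eq hv; have ew := weight_ae_eq hw.
have ev' := weight_ae_eq_sym hv; have ew' := weight_ae_eq_sym hw.
apply: (iff_trans (opnorm_bounded_iff hv hw)).
apply: (iff_trans (weighted_bound_iff_testing wi vi _ _)).
- exact: positive_version_gt0.
- exact: positive_version_gt0.
split=> -[C [t1 t2]]; exists C; split.
- exact: ae_eq_testing wi.1 mw vi.1 mv ew' ev' t1.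
- exact: ae_eq_testing vi.1 mv wi.1 mw ev' ew' t2.
- exact: ae_eq_testing mw wi.1 mv vi.1 ew ev t1.
- exact: ae_eq_testing mv vi.1 mw wi.1 ev ew t2.
Qed.
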